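(* Let $M$ be a matrix with positive entries. If $M$ is on the boundary of $\mathcal{M}_{3,2}^{p\times q}$, then all size-$2$ psd factorizations of $M$ are $1$-infinitesimally rigid (equivalently, $2$-infinitesimally rigid, locally rigid, or globally rigid).
   Context: $\mathcal{S}^2$ (resp. $\mathcal{S}^2_+$) is the set of real symmetric (resp. symmetric positive semidefinite, psd) $2\times2$ matrices; $\langle X,Y\rangle=\operatorname{trace}(XY)$. A size-$k$ psd factorization of a nonnegative $p\times q$ matrix $M$ is a tuple $A^{(1)},\dots,A^{(p)},B^{(1)},\dots,B^{(q)}$ of $k\times k$ psd matrices with $M_{ij}=\langle A^{(i)},B^{(j)}\rangle$; the psd rank of $M$ is the smallest such $k$. $\mathcal{M}_{3,2}^{p\times q}$ is the set of nonnegative $p\times q$ matrices of rank $3$ and psd rank $2$; its boundary is its topological boundary inside the space of all real $p\times q$ matrices of rank $3$. For $s\in\{1,2\}$, an $s$-infinitesimal motion of a size-$2$ psd factorization is a tuple $(\dot A^{(1)},\dots,\dot A^{(p)},\dot B^{(1)},\dots,\dot B^{(q)})$ of matrices in $\mathcal{S}^2$ such that (1) $\langle\dot A^{(i)},B^{(j)}\rangle+\langle A^{(i)},\dot B^{(j)}\rangle=0$ for all $i,j$; and (2) there is $\varepsilon>0$ such that for all $t\in[0,\varepsilon)$ and all nonempty $I\subseteq\{1,2\}$, $T^s([A^{(i)}+t\dot A^{(i)}]_I)\ge0$ for all $i$ and $T^s([B^{(j)}+t\dot B^{(j)}]_I)\ge0$ for all $j$. Here $[X]_I$ is the principal minor of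 $X$ with index set $I$, and $T^s(f)$ is the Taylor polynomial of order $s$ at $t=0$ of the polynomial $f(t)$. Put $\operatorname{vec}(X)=(X_{11},X_{22},\sqrt2X_{12})$ (row vector). If $M\in\mathcal{M}_{3,2}^{p\times q}$, every $s$-infinitesimal motion is given by a unique $D\in\mathbb{R}^{3\times3}$ via $\operatorname{vec}(\dot A^{(i)})=\operatorname{vec}(A^{(i)})D$ and $\operatorname{vec}(\dot B^{(j)})^T=-D\operatorname{vec}(B^{(j)})^T$. The motion is $s$-trivial if the same $D$ gives, by these formulas, an $s$-infinitesimal motion of every size-$2$ psd factorization of every matrix in $\mathcal{M}_{3,2}^{p\times q}$. A size-$2$ psd factorization of $M$ is $s$-infinitesimally rigid if all its $s$-infinitesimal motions are $s$-trivial. $\mathrm{GL}(2)$ acts on size-$2$ psd factorizations of $M$ by $(A^{(i)},B^{(j)})\mapsto(S^TA^{(i)}S,S^{-1}B^{(j)}S^{-T})$. A size-$2$ psd factorization of $M$ is locally rigid if it has a neighborhood, in the space of all size-$2$ psd factorizations of $M$ (Euclidean topology), in which every psd factorization of $M$ lies in its $\mathrm{GL}(2)$-orbit; it is globally rigid if every size-$2$ psd factorization of $M$ lies in its $\mathrm{GL}(2)$-orbit. *)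

(* Defs.v *)
From mathcomp Require Import all_boot all_order all_algebra.
From mathcomp Require Import all_classical all_reals all_analysis.

Set Implicit Arguments.
Unset Strict Implicit.
Unset Printing Implicit Defensive.

Import Order.TTheory GRing.Theory Num.Theory numFieldNormedType.Exports.

Local Open Scope classical_set_scope.
Local Open Scope ring_scope.

Definition psd (R : realType) (k : nat) (X : 'M[R]_k) : Prop :=
  X^T = X /\ forall v : 'cV[R]_k, 0 <= (v^T *m X *m v) 0 0.

Definition psd_factorization (R : realType) (p q k : nat) (M : 'M[R]_(p, q))
    (A : 'I_p -> 'M[R]_k) (B : 'I_q -> 'M[R]_k) : Prop :=
  [/\ forall i, psd (A i), forall j, psd (B j)
    & forall i j, M i j = \tr (A i *m B j)].

Definition has_psd_factorization (R : realType) (p q : nat)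
    (M : 'M[R]_(p, q)) (k : nat) : Prop :=
  exists (A : 'I_p -> 'M[R]_k) (B : 'I_q -> 'M[R]_k), psd_factorization M A B.

(* Every nonnegative matrix has a psd rank (diagonal factors of size q exist),
   so the rank may be specified by a relation. *)
Definition psd_rank_is (R : realType) (p q : nat) (M : 'M[R]_(p, q))
    (k : nat) : Prop :=
  has_psd_factorization M k /\
  forall k' : nat, has_psd_factorization M k' -> (k <= k')%N.

Definition rank3 (R : realType) (p q : nat) : set 'M[R]_(p, q) :=
  [set M : 'M[R]_(p, q) | \rank M = 3%N].

Definition M32 (R : realType) (p q : nat) : set 'M[R]_(p, q) :=
  [set M : 'M[R]_(p, q) |
    [/\ forall i j, 0 <= M i j, \rank M = 3%N & psd_rank_is M 2]].

(* The boundary is taken in the subspace topology of the rank-3 matrices.  The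
   type [subspace X] also contains the points outside X, but as isolated points,
   so none of them is in the boundary of a subset of X. *)
Definition boundary_M32 (R : realType) (p q : nat) : set 'M[R]_(p, q) :=
  let S : set (subspace (@rank3 R p q)) := @M32 R p q in
  closure S `\` interior S.

Definition principal_minor (K : comNzRingType) (n : nat) (I : {set 'I_n})
    (X : 'M[K]_n) : K :=
  \det (mxsub (fun a : 'I_#|I| => enum_val a) (fun a : 'I_#|I| => enum_val a) X).

(* [X + tX']_I, as a polynomial in t. *)
Definition minor_along (R : realType) (n : nat) (I : {set 'I_n})
    (X X' : 'M[R]_n) : {poly R} :=
  principal_minor I (map_mx polyC X + 'X *: map_mx polyC X').

(* f^`N(i) is the i-th derivative divided by i!. *)
Definition taylor (R : realType) (s : nat) (f : {poly R}) : {poly R} :=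
  \sum_(i < s.+1) (f^`N(i)).[0] *: 'X^i.

Definition inf_motion (R : realType) (p q s : nat)
    (A : 'I_p -> 'M[R]_2) (B : 'I_q -> 'M[R]_2)
    (A' : 'I_p -> 'M[R]_2) (B' : 'I_q -> 'M[R]_2) : Prop :=
  [/\ (forall i, (A' i)^T = A' i) /\ (forall j, (B' j)^T = B' j),
      forall i j, \tr (A' i *m B j) + \tr (A i *m B' j) = 0
    & exists2 e : R, 0 < e &
      forall t : R, 0 <= t -> t < e ->
      forall I : {set 'I_2}, I != finset.set0 ->
        (forall i, 0 <= (taylor s (minor_along I (A i) (A' i))).[t]) /\
        (forall j, 0 <= (taylor s (minor_along I (B j) (B' j))).[t])].

Definition vec (R : realType) (X : 'M[R]_2) : 'rV[R]_3 :=
  \row_(c < 3) [:: X 0 0; X 1 1; Num.sqrt 2 * X 0 1]`_c.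

Definition motion_given_by (R : realType) (p q : nat) (D : 'M[R]_3)
    (A : 'I_p -> 'M[R]_2) (B : 'I_q -> 'M[R]_2)
    (A' : 'I_p -> 'M[R]_2) (B' : 'I_q -> 'M[R]_2) : Prop :=
  (forall i, vec (A' i) = vec (A i) *m D) /\
  (forall j, (vec (B' j))^T = - (D *m (vec (B j))^T)).

(* For a factorization of a matrix in M32 the matrix D is unique, since the
   vectors vec (A i), and likewise vec (B j), span R^3. *)
Definition trivial_motion (R : realType) (p q s : nat)
    (A : 'I_p -> 'M[R]_2) (B : 'I_q -> 'M[R]_2)
    (A' : 'I_p -> 'M[R]_2) (B' : 'I_q -> 'M[R]_2) : Prop :=
  exists2 D : 'M[R]_3, motion_given_by D A B A' B' &
    forall (N : 'M[R]_(p, q)) (E : 'I_p -> 'M[R]_2) (F : 'I_q -> 'M[R]_2),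
      @M32 R p q N -> psd_factorization N E F ->
      exists (E' : 'I_p -> 'M[R]_2) (F' : 'I_q -> 'M[R]_2),
        motion_given_by D E F E' F' /\ inf_motion s E F E' F'.

Definition inf_rigid (R : realType) (p q s : nat)
    (A : 'I_p -> 'M[R]_2) (B : 'I_q -> 'M[R]_2) : Prop :=
  forall (A' : 'I_p -> 'M[R]_2) (B' : 'I_q -> 'M[R]_2),
    inf_motion s A B A' B' -> trivial_motion s A B A' B'.

Definition in_GL2_orbit (R : realType) (p q : nat)
    (A : 'I_p -> 'M[R]_2) (B : 'I_q -> 'M[R]_2)
    (A' : 'I_p -> 'M[R]_2) (B' : 'I_q -> 'M[R]_2) : Prop :=
  exists2 S : 'M[R]_2, S \in unitmx &
    (forall i, A' i = S^T *m A i *m S) /\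
    (forall j, B' j = invmx S *m B j *m (invmx S)^T).

(* [ball] on matrices bounds all entries; these balls generate the Euclidean
   topology. *)
Definition locally_rigid (R : realType) (p q : nat) (M : 'M[R]_(p, q))
    (A : 'I_p -> 'M[R]_2) (B : 'I_q -> 'M[R]_2) : Prop :=
  exists2 e : R, 0 < e &
    forall (A' : 'I_p -> 'M[R]_2) (B' : 'I_q -> 'M[R]_2),
      psd_factorization M A' B' ->
      (forall i, ball (A i) e (A' i)) -> (forall j, ball (B j) e (B' j)) ->
      in_GL2_orbit A B A' B'.

Definition globally_rigid (R : realType) (p q : nat) (M : 'M[R]_(p, q))
    (A : 'I_p -> 'M[R]_2) (B : 'I_q -> 'M[R]_2) : Prop :=
  forall (A' : 'I_p -> 'M[R]_2) (B' : 'I_q -> 'M[R]_2),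
    psd_factorization M A' B' -> in_GL2_orbit A B A' B'.

(* Main.v *)
Require Import Defs.
From mathcomp Require Import all_boot all_order all_algebra.
From mathcomp Require Import all_classical all_reals all_analysis.
From mathcomp Require Import ring lra.
Import Order.TTheory GRing.Theory Num.Theory numFieldNormedType.Exports.
Local Open Scope ring_scope.

Set Implicit Arguments.
Unset Strict Implicit.
Unset Printing Implicit Defensive.

(** In the coordinates of [vec], the psd matrices form the closed Lorentz cone
    of R^3, bounded by the conic of rank-one matrices, and the determinant is
    half of the Lorentz form J. A psd factorization of a matrix of rank 3
    places the vectors A i in this cone and the cone in all the half-spaces <B
    j, x> >= 0. The contacts are where these inclusions are tight: the A i of
    rank one, which lie on the boundary of the cone, and for the B j of rank
    one the points adj (B j), where the plane orthogonal to B j touches the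
    cone. Since the entries of M are positive, a contact of the first kind and
    one of the second kind are never on the same ray.

    Everything rests on one fact, [weak_separation_trivial]: if M is a
    boundary point, a quadratic form that is nonnegative at the contacts of A
    and nonpositive at those of B is a multiple of J. Indeed, a form H that is
    not restricts to a nonzero binary quartic on the conic, which has at most
    four roots on the projective line. By interpolation ([separating_form])
    some other quartic G has the right strict sign at the contacts among these
    roots, so that H + e G has the right strict signs at all contacts for
    small e > 0. Moving the cone with velocity given by H + e G makes all
    factors positive definite without changing M ([near_M32_of_strict]), and
    positive definite factors can be adjusted to any rank 3 matrix close to M
    ([near_M32]); so M is interior.

    The four rigidity properties are applications to three forms. A motion
    with matrix D keeps the singular factors in the cone to first order, which
    says that D J weakly separates the contacts; so D J + J D^T = c J, and
    such a D acts on every factorization to first order. For a motion of order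
    2 the second-order terms of the determinants give a further weakly
    separating form, which forces D to be scalar, and scalings act on every
    factorization exactly. Finally, if T carries a factorization to another
    one, then T J T^T weakly separates the contacts, so T is a similarity of
    the Lorentz form that preserves the cone, and these are the congruences by
    elements of GL(2) ([lorentz_congruence]). *)

(** * Coordinates in dimensions 2 and 3 *)

Lemma forall_ord2 (P : 'I_2 -> Prop) : P 0 -> P 1 -> forall i, P i.
Proof.
move=> P0 P1 [[|[|//]] lt_i2].
- by rewrite (_ : Ordinal lt_i2 = 0) //; apply: val_inj.
- by rewrite (_ : Ordinal lt_i2 = 1) //; apply: val_inj.
Qed.

Lemma forall_ord3 (P : 'I_3 -> Prop) : P 0 -> P 1 -> P 2 -> forall i, P i.
Proof.
move=> P0 P1 P2 [[|[|[|//]]] lt_i3].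
- by rewrite (_ : Ordinal lt_i3 = 0) //; apply: val_inj.
- by rewrite (_ : Ordinal lt_i3 = 1) //; apply: val_inj.
- by rewrite (_ : Ordinal lt_i3 = 2) //; apply: val_inj.
Qed.

Lemma big_ord2 (V : nmodType) (F : 'I_2 -> V) : \sum_i F i = F 0 + F 1.
Proof.
rewrite !big_ord_recl big_ord0 addr0.
by congr (F _ + F _); apply: val_inj.
Qed.

Lemma big_ord3 (V : nmodType) (F : 'I_3 -> V) : \sum_i F i = F 0 + F 1 + F 2.
Proof.
rewrite !big_ord_recl big_ord0 addr0 addrA.
by congr (F _ + F _ + F _); apply: val_inj.
Qed.

Lemma det2 (R : comNzRingType) (X : 'M[R]_2) :
  \det X = X 0 0 * X 1 1 - X 0 1 * X 1 0.
Proof.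
have E : forall i j : 'I_1, i = j by move=> i j; rewrite !ord1.
rewrite (expand_det_row _ 0) big_ord2 /cofactor !det_mx11 !mxE /=.
rewrite (_ : lift 0 0 = 1 :> 'I_2); last exact: val_inj.
rewrite (_ : lift 1 0 = 0 :> 'I_2); last exact: val_inj.
by rewrite expr0 expr1 mul1r mulN1r mulrN.
Qed.

(** * Psd matrices as vectors of the Lorentz cone *)

(** The form [x0 * x1 *+ 2 - x2 ^+ 2], twice the determinant in the
    coordinates of [vec]. It is also the matrix of the adjugate, see
    [vec_adj]. *)
Definition lorentz (R : nzRingType) : 'M[R]_3 :=
  \matrix_(i < 3, j < 3)
    nth 0 (nth [::] [:: [:: 0; 1; 0]; [:: 1; 0; 0]; [:: 0; 0; -1]] i) j.

Definition qform (R : nzRingType) (H : 'M[R]_3) (x : 'rV[R]_3) : R :=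
  (x *m H *m x^T) 0 0.

Lemma tr_lorentz (R : nzRingType) : (lorentz R)^T = lorentz R.
Proof. by apply/matrixP; apply: forall_ord3; apply: forall_ord3; rewrite !mxE. Qed.

Lemma mul_lorentz (R : nzRingType) : lorentz R *m lorentz R = 1%:M.
Proof.
apply/matrixP; apply: forall_ord3; apply: forall_ord3;
  by rewrite !mxE big_ord3 !mxE /=
    ?(mul0r, mulr0, mulr1, mul1r, addr0, add0r, mulrN, oppr0, opprK).
Qed.

Lemma mul_lorentzK (R : nzRingType) (m : nat) (X : 'M[R]_(m, 3)) :
  X *m lorentz R *m lorentz R = X.
Proof. by rewrite -mulmxA mul_lorentz mulmx1. Qed.

Lemma qformE (R : comNzRingType) (H : 'M[R]_3) (x : 'rV[R]_3) :
  qform H x = H 0 0 * x 0 0 ^+ 2 + H 1 1 * x 0 1 ^+ 2 + H 2 2 * x 0 2 ^+ 2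
    + (H 0 1 + H 1 0) * (x 0 0 * x 0 1) + (H 0 2 + H 2 0) * (x 0 0 * x 0 2)
    + (H 1 2 + H 2 1) * (x 0 1 * x 0 2).
Proof. rewrite /qform !mxE !big_ord3 !mxE !big_ord3; ring. Qed.

Lemma qform_lorentzE (R : comNzRingType) (x : 'rV[R]_3) :
  qform (lorentz R) x = x 0 0 * x 0 1 *+ 2 - x 0 2 ^+ 2.
Proof. rewrite qformE !mxE /=; ring. Qed.

Lemma qformD (R : nzRingType) (H G : 'M[R]_3) (x : 'rV[R]_3) :
  qform (H + G) x = qform H x + qform G x.
Proof. by rewrite /qform mulmxDr mulmxDl mxE. Qed.

Lemma qformZ (R : comNzRingType) (c : R) (H : 'M[R]_3) (x : 'rV[R]_3) :
  qform (c *: H) x = c * qform H x.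
Proof. by rewrite /qform -scalemxAr -scalemxAl mxE. Qed.

Lemma qform_tr (R : comNzRingType) (H : 'M[R]_3) (x : 'rV[R]_3) :
  qform H^T x = qform H x.
Proof. by rewrite /qform -(trmxK x) -!trmx_mul trmxK mulmxA mxE. Qed.

Lemma qform_mul (R : comNzRingType) (H K : 'M[R]_3) (x : 'rV[R]_3) :
  qform H (x *m K) = qform (K *m H *m K^T) x.
Proof. by rewrite /qform trmx_mul !mulmxA. Qed.

Definition unvec (R : realType) (x : 'rV[R]_3) : 'M[R]_2 :=
  \matrix_(i, j) if i == j then x 0 (if i == 0 then 0 else 1)
                 else (Num.sqrt 2)^-1 * x 0 2.

Section Vec.
Context {R : realType}.
Implicit Types (X Y : 'M[R]_2) (x : 'rV[R]_3).

Lemma sqrt2K : Num.sqrt 2 * Num.sqrt 2 = 2 :> R.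
Proof. by rewrite -expr2 sqr_sqrtr. Qed.

Lemma sqrt2_neq0 : Num.sqrt 2 != 0 :> R.
Proof. by rewrite sqrtr_eq0 -ltNge. Qed.

Lemma vecE X : ((vec X 0 0 = X 0 0)%R * (vec X 0 1 = X 1 1)%R
  * (vec X 0 2 = Num.sqrt 2 * X 0 1)%R)%type.
Proof. by rewrite !mxE. Qed.

Lemma unvecE x : ((unvec x 0 0 = x 0 0)%R * (unvec x 1 1 = x 0 1)%R
  * (unvec x 0 1 = (Num.sqrt 2)^-1 * x 0 2)%R
  * (unvec x 1 0 = (Num.sqrt 2)^-1 * x 0 2)%R)%type.
Proof. by rewrite !mxE. Qed.

Lemma symE X : X^T = X -> X 1 0 = X 0 1.
Proof. by move=> symX; rewrite -{1}symX mxE. Qed.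

Lemma tr_unvec x : (unvec x)^T = unvec x.
Proof.
by apply/matrixP; apply: forall_ord2; apply: forall_ord2; rewrite !mxE.
Qed.

Lemma unvecK x : vec (unvec x) = x.
Proof.
apply/rowP; apply: forall_ord3; rewrite !vecE !unvecE //.
by rewrite mulrA mulfV ?mul1r // sqrt2_neq0.
Qed.

Lemma vec_inj X Y : X^T = X -> Y^T = Y -> vec X = vec Y -> X = Y.
Proof.
move=> symX symY /rowP eXY; have e01 : X 0 1 = Y 0 1.
  by apply: (mulfI sqrt2_neq0); have := eXY 2; rewrite !vecE.
apply/matrixP; apply: forall_ord2; apply: forall_ord2; rewrite ?symE ?e01 //.
- by have := eXY 0; rewrite !vecE.
- by have := eXY 1; rewrite !vecE.
Qed.

Lemma vec0 : vec (0 : 'M[R]_2) = 0.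
Proof. by apply/rowP; apply: forall_ord3; rewrite !vecE !mxE ?mulr0. Qed.

Lemma unvec0 : unvec (0 : 'rV[R]_3) = 0.
Proof. by rewrite -vec0; apply: vec_inj; rewrite ?tr_unvec ?trmx0 ?unvecK. Qed.

Lemma tr_mul_vec X Y : X^T = X -> Y^T = Y ->
  \tr (X *m Y) = (vec X *m (vec Y)^T) 0 0.
Proof.
move=> symX symY; rewrite /mxtrace big_ord2 !mxE !big_ord2 big_ord3 !mxE /=.
rewrite !symE //; have := sqrt2K; move: (Num.sqrt 2) => s s2.
rewrite (_ : s * X 0 1 * (s * Y 0 1) = (s * s) * (X 0 1 * Y 0 1)); last ring.
rewrite s2; ring.
Qed.

Lemma qform_lorentz_vec X : X^T = X -> qform (lorentz R) (vec X) = \det X *+ 2.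
Proof.
move=> symX; rewrite qform_lorentzE det2 !vecE symE //.
rewrite exprMn expr2 sqrt2K; ring.
Qed.

Lemma quadE X (v : 'cV[R]_2) : X^T = X ->
  (v^T *m X *m v) 0 0 = X 0 0 * v 0 0 ^+ 2 + X 1 1 * v 1 0 ^+ 2
    + X 0 1 * v 0 0 * v 1 0 *+ 2.
Proof.
by move=> symX; rewrite !mxE !big_ord2 !mxE !big_ord2 !mxE (symE symX); ring.
Qed.

Lemma psd_quad_ge0 X (a b : R) : psd X ->
  0 <= X 0 0 * a ^+ 2 + X 1 1 * b ^+ 2 + X 0 1 * a * b *+ 2.
Proof.
case=> symX /(_ (\col_i (if i == 0 then a else b))).
by rewrite quadE // !mxE.
Qed.

(** When a diagonal entry vanishes the quadratic form is affine in the other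
    variable, which forces the off-diagonal entry to vanish; otherwise
    complete the square. *)
Lemma psdP X : X^T = X ->
  psd X <-> [/\ 0 <= X 0 0, 0 <= X 1 1 & 0 <= \det X].
Proof.
move=> symX; rewrite det2 (symE symX); split=> [psdX|[X0 X1 Xd]].
  have X_ge0 a b := psd_quad_ge0 a b psdX.
  have X0 : 0 <= X 0 0 by have := X_ge0 1 0; lra.
  have X1 : 0 <= X 1 1 by have := X_ge0 0 1; lra.
  split=> //; have [X00|X0_neq0] := eqVneq (X 0 0) 0.
    have [X01|X01] := eqVneq (X 0 1) 0; first by rewrite X00 X01; lra.
    (* the form is then affine and non-constant along b = X 0 1 *)
    have := X_ge0 (- (X 1 1 + 1) / 2) (X 0 1); rewrite X00.
    have : 0 < X 0 1 ^+ 2 by rewrite exprn_even_gt0.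
    nra.
  have {X0_neq0} X0 : 0 < X 0 0 by rewrite lt_def X0_neq0.
  rewrite -(pmulr_rge0 _ X0); have := X_ge0 (- X 0 1) (X 0 0); nra.
split=> // v; rewrite quadE //; move: (v 0 0) (v 1 0) => a b.
have [X00|X0_neq0] := eqVneq (X 0 0) 0.
  have : X 0 1 ^+ 2 <= 0 by rewrite X00 in Xd; nra.
  rewrite exprn_even_le0 //= => /eqP ->; rewrite X00; nra.
have {X0_neq0} X0' : 0 < X 0 0 by rewrite lt_def X0_neq0.
rewrite -(pmulr_rge0 _ X0').
have -> : X 0 0 * (X 0 0 * a ^+ 2 + X 1 1 * b ^+ 2 + X 0 1 * a * b *+ 2)
  = (X 0 0 * a + X 0 1 * b) ^+ 2 + (X 0 0 * X 1 1 - X 0 1 * X 0 1) * b ^+ 2.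
  by ring.
by apply: addr_ge0; [exact: sqr_ge0|apply: mulr_ge0 => //; exact: sqr_ge0].
Qed.

Lemma psd_sym k (X : 'M[R]_k) : psd X -> X^T = X. Proof. by case. Qed.

Lemma psd_ge0 X : psd X -> [/\ 0 <= X 0 0, 0 <= X 1 1 & 0 <= \det X].
Proof. by move=> psdX; apply/psdP => //; apply: psd_sym. Qed.

Lemma psd_offdiag0 X : psd X -> X 0 0 = 0 \/ X 1 1 = 0 -> X 0 1 = 0.
Proof.
move=> psdX; have [X0 X1] := psd_ge0 psdX.
rewrite det2 (symE (psd_sym psdX)) => Xd X00.
have : X 0 1 ^+ 2 <= 0 by case: X00 => X00; rewrite X00 in Xd; nra.
by rewrite exprn_even_le0 //= => /eqP.
Qed.

Lemma psd_eq0 X : psd X -> X 0 0 + X 1 1 <= 0 -> X = 0.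
Proof.
move=> psdX X_le0; have [X0 X1 _] := psd_ge0 psdX.
have X00 : X 0 0 = 0 by lra.
have X11 : X 1 1 = 0 by lra.
have X01 := psd_offdiag0 psdX (or_introl X00).
apply/matrixP; apply: forall_ord2; apply: forall_ord2;
  by rewrite !mxE ?(symE (psd_sym psdX)).
Qed.

(** The hyperplane orthogonal to a point of the closed cone does not meet the
    open cone. *)
Lemma det_le0_of_tr0 X Y : psd X -> X != 0 -> Y^T = Y -> \tr (X *m Y) = 0 ->
  \det Y <= 0.
Proof.
move=> psdX X_neq0 symY trXY; rewrite leNgt; apply: contra X_neq0 => detY.
apply/eqP/psd_eq0 => //; have [X0 X1 _] := psd_ge0 psdX.
move: trXY detY; rewrite /mxtrace big_ord2 !mxE !big_ord2 det2 (symE symY).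
rewrite (symE (psd_sym psdX)) => tr0 Yd.
have := psd_quad_ge0 (Y 0 0) (Y 0 1) psdX.
have := psd_quad_ge0 (Y 0 1) (Y 1 1) psdX.
move: (X 0 0) (X 0 1) (X 1 1) (Y 0 0) (Y 0 1) (Y 1 1) X0 X1 tr0 Yd.
move=> a b c u v w a_ge0 c_ge0 tr0 d_gt0 Xv Xu.
(* multiplying the trace by an entry of Y completes a value of the form X *)
have cd : c * (u * w - v * v) = - (a * u ^+ 2 + c * v ^+ 2 + b * u * v *+ 2).
  by rewrite -[RHS](addr0 _) -(mulr0 u) -[in RHS]tr0; ring.
have ad : a * (u * w - v * v) = - (a * v ^+ 2 + c * w ^+ 2 + b * v * w *+ 2).
  by rewrite -[RHS](addr0 _) -(mulr0 w) -[in RHS]tr0; ring.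
have : (a + c) * (u * w - v * v) <= 0 by rewrite mulrDl ad cd; lra.
by rewrite pmulr_lle0.
Qed.

Lemma tr_psd_ge0 X Y : psd X -> psd Y -> 0 <= \tr (X *m Y).
Proof.
move=> psdX psdY; have [Y0 Y1 Yd] := psd_ge0 psdY.
have [X0 X1 _] := psd_ge0 psdX; rewrite /mxtrace big_ord2 !mxE !big_ord2.
move: Yd; rewrite det2 (symE (psd_sym psdX)) (symE (psd_sym psdY)) => Yd.
have [Y00|Y0_neq0] := eqVneq (Y 0 0) 0.
  by rewrite Y00 (psd_offdiag0 psdY (or_introl Y00)); nra.
have Y0_gt0 : 0 < Y 0 0 by rewrite lt_def Y0_neq0.
rewrite -(pmulr_rge0 _ Y0_gt0).
have := psd_quad_ge0 (Y 0 0) (Y 0 1) psdX.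
have := mulr_ge0 X1 Yd; nra.
Qed.

End Vec.
(** * Entrywise limits of matrices *)

Section EntrywiseLimits.
Context {R : realType} {T : Type} {F : set_system T} {FF : Filter F}.

(** Entrywise rather than topological convergence: limits of products,
    determinants and inverses then reduce to limits of reals. *)
Definition mxcvg m n (f : T -> 'M[R]_(m, n)) (l : 'M[R]_(m, n)) : Prop :=
  forall i j, (f x i j @[x --> F] --> l i j)%classic.

Lemma cvg_sum_fin (I : finType) (f : I -> T -> R) (l : I -> R) :
  (forall i, (f i x @[x --> F] --> l i)%classic) ->
  (\sum_i f i x @[x --> F] --> \sum_i l i)%classic.
Proof.
by move=> fl; apply: cvg_big => [|i _]; [exact: add_continuous|exact: fl].
Qed.

Lemma cvg_prod_fin (I : finType) (f : I -> T -> R) (l : I -> R) :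
  (forall i, (f i x @[x --> F] --> l i)%classic) ->
  (\prod_i f i x @[x --> F] --> \prod_i l i)%classic.
Proof.
by move=> fl; apply: cvg_big => [|i _]; [exact: mul_continuous|exact: fl].
Qed.

Lemma mxcvg_cst m n (l : 'M[R]_(m, n)) : mxcvg (fun=> l) l.
Proof. by move=> i j; apply: cvg_cst. Qed.

Lemma mxcvgD m n (f g : T -> 'M[R]_(m, n)) (a b : 'M[R]_(m, n)) :
  mxcvg f a -> mxcvg g b -> mxcvg (fun x => f x + g x) (a + b).
Proof.
move=> fa gb i j; under eq_fun do rewrite mxE.
by rewrite mxE; apply: cvgD; [exact: fa|exact: gb].
Qed.

Lemma mxcvgZ m n (f : T -> R) (g : T -> 'M[R]_(m, n)) (a : R) (b : 'M[R]_(m, n)) :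
  (f x @[x --> F] --> a)%classic -> mxcvg g b ->
  mxcvg (fun x => f x *: g x) (a *: b).
Proof.
move=> fa gb i j; under eq_fun do rewrite mxE.
by rewrite mxE; apply: cvgM; [exact: fa|exact: gb].
Qed.

Lemma mxcvgM m n k (f : T -> 'M[R]_(m, n)) (g : T -> 'M[R]_(n, k))
    (a : 'M[R]_(m, n)) (b : 'M[R]_(n, k)) :
  mxcvg f a -> mxcvg g b -> mxcvg (fun x => f x *m g x) (a *m b).
Proof.
move=> fa gb i j; under eq_fun do rewrite mxE.
by rewrite mxE; apply: cvg_sum_fin => l; apply: cvgM; [exact: fa|exact: gb].
Qed.

Lemma mxcvg_tr m n (f : T -> 'M[R]_(m, n)) (a : 'M[R]_(m, n)) :
  mxcvg f a -> mxcvg (fun x => (f x)^T) a^T.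
Proof. by move=> fa i j; under eq_fun do rewrite mxE; rewrite mxE; apply: fa. Qed.

Lemma mxcvg_row m n i (f : T -> 'M[R]_(m, n)) (a : 'M[R]_(m, n)) :
  mxcvg f a -> mxcvg (fun x => row i (f x)) (row i a).
Proof. by move=> fa j k; under eq_fun do rewrite mxE; rewrite mxE; apply: fa. Qed.

Lemma cvg_det n (f : T -> 'M[R]_n) (a : 'M[R]_n) :
  mxcvg f a -> (\det (f x) @[x --> F] --> \det a)%classic.
Proof.
move=> fa; rewrite /determinant; apply: cvg_sum_fin => s.
apply: cvgM; first exact: cvg_cst.
by apply: cvg_prod_fin => i; apply: fa.
Qed.

Lemma mxcvg_adj n (f : T -> 'M[R]_n) (a : 'M[R]_n) :
  mxcvg f a -> mxcvg (fun x => \adj (f x)) (\adj a).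
Proof.
move=> fa i j; under eq_fun do rewrite mxE.
rewrite mxE /cofactor; apply: cvgM; first exact: cvg_cst.
by apply: cvg_det => k l; under eq_fun do rewrite !mxE; rewrite !mxE; apply: fa.
Qed.

Lemma near_unitmx n (f : T -> 'M[R]_n) (a : 'M[R]_n) :
  mxcvg f a -> a \in unitmx -> \forall x \near F, f x \in unitmx.
Proof.
move=> fa; rewrite unitmxE unitfE => a_unit.
have det_neq0 : \forall x \near F, \det (f x) != 0.
  exact: cvgr_neq0 (cvg_det fa) a_unit.
by apply: filterS det_neq0 => x; rewrite unitmxE unitfE.
Qed.

Lemma mxcvg_inv n (f : T -> 'M[R]_n) (a : 'M[R]_n) :
  mxcvg f a -> a \in unitmx -> mxcvg (fun x => invmx (f x)) (invmx a).
Proof.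
move=> fa a_unit i j.
have lim : mxcvg (fun x => (\det (f x))^-1 *: \adj (f x)) (invmx a).
  rewrite /invmx a_unit; apply: mxcvgZ; last exact: mxcvg_adj.
  by apply: cvgV; [rewrite -unitfE -unitmxE|exact: cvg_det].
apply: cvg_trans (lim i j); apply: near_eq_cvg.
by apply: filterS (near_unitmx fa a_unit) => x; rewrite /invmx => ->.
Qed.

End EntrywiseLimits.
Arguments mxcvg {R T} F {m n}.
Arguments mxcvg_cst {R T F FF m n} l.

(** The cone of positive definite matrices. A positive determinant leaves the
    two definite signs, and the trace distinguishes them; unlike a single
    diagonal entry, the trace is positive at every nonzero psd matrix. *)
Definition in_open_cone (R : realType) (x : 'rV[R]_3) : Prop :=
  0 < x 0 0 + x 0 1 /\ 0 < qform (lorentz R) x.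

Lemma psd_unvec (R : realType) (x : 'rV[R]_3) :
  in_open_cone x -> psd (unvec x).
Proof.
case=> tr_gt0; have := qform_lorentz_vec (tr_unvec x).
rewrite unvecK => -> det_gt0; apply/psdP; first exact: tr_unvec.
move: det_gt0; rewrite det2 (symE (tr_unvec x)) !unvecE.
move: tr_gt0 (_ * x 0 2); move: (x 0 0) (x 0 1) => a b ab c abc.
have a_gt0 : 0 < a by nra.
by split; nra.
Qed.

Lemma near_in_open_cone (R : realType) (T : Type) (F : set_system T)
    {FF : Filter F} (f : T -> 'rV[R]_3) (l : 'rV[R]_3) :
  mxcvg F f l -> in_open_cone l -> \forall x \near F, in_open_cone (f x).
Proof.
move=> fl [tr_gt0 q_gt0]; apply: filterI.
  by apply: cvgr_gt _ tr_gt0; apply: cvgD; exact: fl.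
apply: cvgr_gt _ q_gt0.
apply: mxcvgM (mxcvg_tr fl) _ _; apply: mxcvgM => //; exact: mxcvg_cst.
Qed.

(** * Interior of the set of matrices of rank 3 and psd rank 2 *)

Section Factorization.
Context {R : realType} {p q : nat}.
Implicit Types (M N : 'M[R]_(p, q)) (A : 'I_p -> 'M[R]_2) (B : 'I_q -> 'M[R]_2).

Definition rows (A : 'I_p -> 'M[R]_2) : 'M[R]_(p, 3) :=
  \matrix_(i, c) vec (A i) 0 c.
Definition cols (B : 'I_q -> 'M[R]_2) : 'M[R]_(3, q) :=
  \matrix_(c, j) vec (B j) 0 c.

Lemma row_rows A i : row i (rows A) = vec (A i).
Proof. by apply/rowP => c; rewrite !mxE. Qed.

Lemma tr_col_cols B j : (col j (cols B))^T = vec (B j).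
Proof. by apply/rowP => c; rewrite !mxE. Qed.

Lemma mulmx_row_col m n k (X : 'M[R]_(m, n)) (Y : 'M[R]_(n, k)) i j :
  (X *m Y) i j = (row i X *m col j Y) 0 0.
Proof. by rewrite !mxE; apply: eq_bigr => c _; rewrite !mxE. Qed.

Lemma mul_rows_cols A B i j : (forall i, (A i)^T = A i) ->
  (forall j, (B j)^T = B j) ->
  (rows A *m cols B) i j = \tr (A i *m B j).
Proof.
move=> symA symB; rewrite tr_mul_vec // -row_rows -tr_col_cols trmxK.
exact: mulmx_row_col.
Qed.

Lemma factorizationE M A B : psd_factorization M A B -> M = rows A *m cols B.
Proof.
case=> psdA psdB MAB; apply/matrixP => i j; rewrite mul_rows_cols ?MAB //.
- by move=> k; case: (psdA k).
- by move=> k; case: (psdB k).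
Qed.

Lemma psd_rank_ge2 M k : \rank M = 3%N -> has_psd_factorization M k -> (2 <= k)%N.
Proof.
move=> rkM [A [B [_ _ MAB]]]; case: k => [|[|//]] in A B MAB *.
  suff M0 : M = 0 by rewrite M0 mxrank0 in rkM.
  by apply/matrixP => i j; rewrite MAB mxE /mxtrace big_ord0.
suff MuV : M = (\col_i A i 0 0) *m (\row_j B j 0 0).
  have := mxrankM_maxr (\col_i A i 0 0) (\row_j B j 0 0); rewrite -MuV rkM.
  by move/leq_trans/(_ (rank_leq_row _)).
apply/matrixP => i j.
by rewrite MAB /mxtrace !mxE !big_ord1 !mxE big_ord1 !ord1.
Qed.

Lemma M32_of_factorization M A B :
  psd_factorization M A B -> \rank M = 3%N -> M32 M.
Proof.
move=> fM rkM; split=> // [i j|].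
  by have [psdA psdB ->] := fM; apply: tr_psd_ge0.
split; first by exists A, B.
by move=> k; apply: psd_rank_ge2.
Qed.

Lemma rank3_factors M (U : 'M[R]_(p, 3)) (V : 'M[R]_(3, q)) :
  \rank M = 3%N -> M = U *m V -> row_full U /\ row_free V.
Proof.
move=> rk3 MUV; split.
  by rewrite /row_full eqn_leq rank_leq_col -[leqLHS]rk3 MUV mxrankM_maxl.
by rewrite /row_free eqn_leq rank_leq_row -[leqLHS]rk3 MUV mxrankM_maxr.
Qed.

(** Positive definite factors survive perturbation. With a left inverse L of U
    and a right inverse W of V, the factors N W and (L N W)^-1 L N depend
    continuously on N, are U and V at N = M, and multiply to N as long as N
    has rank 3, because N then has the same row space as L N. *)
Lemma near_M32 M (U : 'M[R]_(p, 3)) (V : 'M[R]_(3, q)) : \rank M = 3%N ->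
  M = U *m V -> (forall i, in_open_cone (row i U)) ->
  (forall j, in_open_cone (row j V^T)) ->
  \forall N \near M, \rank N = 3%N -> M32 N.
Proof.
move=> rkM MUV coneU coneV.
have [/row_fullP[L LU] /row_freeP[W VW]] := rank3_factors rkM MUV.
pose C N := L *m N *m W; pose U' N := N *m W.
pose V' N := invmx (C N) *m (L *m N).
have limN : mxcvg (nbhs M) id M by move=> i j; apply: coord_continuous.
have UM : U' M = U by rewrite /U' MUV -mulmxA VW mulmx1.
have CM : C M = 1%:M by rewrite /C -mulmxA -/(U' M) UM.
have C_unit : C M \in unitmx by rewrite CM unitmx1.
have VM : V' M = V by rewrite /V' CM invmx1 mul1mx MUV mulmxA LU mul1mx.
have limU : mxcvg (nbhs M) U' (U' M) by exact: mxcvgM limN (mxcvg_cst W).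
have limLN : mxcvg (nbhs M) (mulmx L) (L *m M).
  exact: mxcvgM (mxcvg_cst L) limN.
have limC : mxcvg (nbhs M) C (C M) by exact: mxcvgM limLN (mxcvg_cst W).
have limV : mxcvg (nbhs M) V' (V' M).
  exact: mxcvgM (mxcvg_inv limC C_unit) limLN.
have nearU i : \forall N \near M, in_open_cone (row i (U' N)).
  by apply: near_in_open_cone (mxcvg_row limU) _; rewrite UM.
have nearV j : \forall N \near M, in_open_cone (row j (V' N)^T).
  by apply: near_in_open_cone (mxcvg_row (mxcvg_tr limV)) _; rewrite VM.
near=> N => rkN.
have unitCN : C N \in unitmx by near: N; exact: near_unitmx limC C_unit.
have NUV : N = U' N *m V' N.
  have rkLN : \rank (L *m N) = 3%N.
    apply/eqP; rewrite eqn_leq rank_leq_row /=.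
    by rewrite -[leqLHS](mxrank_unit unitCN) mxrankM_maxl.
  have /submxP[X NX] : (N <= L *m N)%MS.
    have := mxrank_leqif_eq (submxMl L N); rewrite rkLN rkN => /leqif_refl.
    by case/andP.
  have NW : N *m W = X *m C N by rewrite {1}NX /C !mulmxA.
  by rewrite /U' /V' NW mulmxA mulmxK.
apply: (M32_of_factorization (A := fun i => unvec (row i (U' N)))
  (B := fun j => unvec (row j (V' N)^T))) => //; split.
- move=> i; apply: psd_unvec; move: i; near: N; exact: filter_forall nearU.
- move=> j; apply: psd_unvec; move: j; near: N; exact: filter_forall nearV.
- move=> i j; rewrite tr_mul_vec ?tr_unvec // !unvecK.
  by rewrite -tr_col trmxK -mulmx_row_col -NUV.
Unshelve. all: by end_near. Qed.
End Factorization.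

(** * Pushing a cone off its contacts *)

(** Points outside of the rank 3 matrices are isolated, so they are in the
    closure of a set only if they belong to it. *)
Lemma boundary_rank3 (R : realType) (p q : nat) (M : 'M[R]_(p, q)) :
  boundary_M32 M -> \rank M = 3%N.
Proof.
case=> clM _; apply: contrapT => rkM.
have nbhsM : nbhs (M : subspace (@rank3 R p q)) [set M]%classic.
  change (nbhs_subspace (M : subspace (@rank3 R p q)) [set M]%classic).
  by rewrite -(nbhs_subspace_out (A := @rank3 R p q) rkM) => N.
by have [N [[_ rkN _] NM]] := clM _ nbhsM; rewrite -NM in rkM.
Qed.

Lemma boundary_not_near (R : realType) (p q : nat) (M : 'M[R]_(p, q)) :
  boundary_M32 M -> ~ \forall N \near M, \rank N = 3%N -> M32 N.
Proof.
move=> bdM; have rkM := boundary_rank3 bdM; case: bdM => _ intM nearM.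
apply: intM.
change (nbhs_subspace (M : subspace (@rank3 R p q)) (@M32 R p q)).
by rewrite -(nbhs_subspace_in (A := @rank3 R p q) rkM).
Qed.

(** At a boundary point x of the cone, the value of the form along x + t z is
    t times a quantity whose limit is twice the pairing of x with l; at an
    interior point there is nothing to gain. *)
Lemma near_enter_cone (R : realType) (x l : 'rV[R]_3) (z : R -> 'rV[R]_3) :
  0 < x 0 0 + x 0 1 -> 0 <= qform (lorentz R) x ->
  (qform (lorentz R) x = 0 -> 0 < (x *m lorentz R *m l^T) 0 0) ->
  mxcvg (0^'+)%classic z l ->
  \forall t \near (0^'+)%classic, in_open_cone (x + t *: z t).
Proof.
move=> tr_gt0 q_ge0 slope_gt0 zl.
have t0 : (t @[t --> 0^'+] --> (0 : R))%classic.
  exact: cvg_at_right_filter cvg_id.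
have limf : mxcvg (0^'+)%classic (fun t => x + t *: z t) x.
  by rewrite -[X in mxcvg _ _ X]addr0 -(scale0r l);
    apply: mxcvgD (mxcvg_cst x) (mxcvgZ t0 zl).
have [q0|q_neq0] := eqVneq (qform (lorentz R) x) 0; last first.
  by apply: near_in_open_cone limf _; split=> //; rewrite lt_def q_neq0.
have expand t : qform (lorentz R) (x + t *: z t) =
    t * ((x *m lorentz R *m (z t)^T) 0 0 *+ 2 + t * qform (lorentz R) (z t)).
  transitivity (qform (lorentz R) x +
    t * ((x *m lorentz R *m (z t)^T) 0 0 *+ 2 + t * qform (lorentz R) (z t))).
    rewrite !qform_lorentzE !mxE !big_ord3 !mxE !big_ord3 !mxE /=; ring.
  by rewrite q0 add0r.
have lim_slope : ((x *m lorentz R *m (z t)^T) 0 0 *+ 2 +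
    t * qform (lorentz R) (z t) @[t --> 0^'+] -->
    (x *m lorentz R *m l^T) 0 0 *+ 2 + 0 * qform (lorentz R) l)%classic.
  apply: cvgD.
    apply: cvgMn; exact: (mxcvgM (mxcvg_cst (x *m lorentz R)) (mxcvg_tr zl)).
  apply: cvgM t0 _.
  exact: (mxcvgM (mxcvgM zl (mxcvg_cst (lorentz R))) (mxcvg_tr zl)).
have slope : \forall t \near (0^'+)%classic,
    0 < (x *m lorentz R *m (z t)^T) 0 0 *+ 2 + t * qform (lorentz R) (z t).
  by apply: cvgr_gt lim_slope _ _; rewrite mul0r addr0 pmulrn_rgt0 // slope_gt0.
have limtr : ((x + t *: z t) 0 0 + (x + t *: z t) 0 1 @[t --> 0^'+] -->
  x 0 0 + x 0 1)%classic by apply: cvgD; apply: limf.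
near=> t; split; first by near: t; apply: cvgr_gt limtr _ tr_gt0.
by rewrite expand; apply: mulr_gt0; near: t; [exact: nbhs_right_gt|].
Unshelve. all: by end_near. Qed.

Section Boundary.
Context {R : realType} {p q : nat} {M : 'M[R]_(p, q)}.
Context {A : 'I_p -> 'M[R]_2} {B : 'I_q -> 'M[R]_2}.
Hypothesis M_gt0 : forall i j, 0 < M i j.
Hypothesis rkM : \rank M = 3%N.
Hypothesis fM : psd_factorization M A B.
Local Notation J := (lorentz R).

Lemma left_factor_psd i : psd (A i). Proof. by case: fM. Qed.
Lemma right_factor_psd j : psd (B j). Proof. by case: fM. Qed.

Lemma rank3_gt0 : (0 < p)%N /\ (0 < q)%N.
Proof.
split.
  by have := rank_leq_row M; rewrite rkM; apply: leq_trans.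
by have := rank_leq_col M; rewrite rkM; apply: leq_trans.
Qed.

Lemma trace_left_gt0 i : 0 < vec (A i) 0 0 + vec (A i) 0 1.
Proof.
rewrite !vecE ltNge; apply/negP => /(psd_eq0 (left_factor_psd i)) A0.
have [_ q_gt0] := rank3_gt0; have [_ _ MAB] := fM.
by have := M_gt0 i (Ordinal q_gt0); rewrite MAB A0 mul0mx mxtrace0 ltxx.
Qed.

Lemma trace_right_gt0 j : 0 < vec (B j) 0 0 + vec (B j) 0 1.
Proof.
rewrite !vecE ltNge; apply/negP => /(psd_eq0 (right_factor_psd j)) B0.
have [p_gt0 _] := rank3_gt0; have [_ _ MAB] := fM.
by have := M_gt0 (Ordinal p_gt0) j; rewrite MAB B0 mulmx0 mxtrace0 ltxx.
Qed.

Lemma qform_psd_ge0 (X : 'M[R]_2) : psd X -> 0 <= qform J (vec X).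
Proof.
move=> psdX; have [_ _ Xd] := psd_ge0 psdX.
by rewrite (qform_lorentz_vec (psd_sym psdX)) pmulrn_lge0.
Qed.

Lemma qform_psd_eq0 (X : 'M[R]_2) : psd X ->
  qform J (vec X) = 0 -> \det X = 0.
Proof.
move=> psdX; rewrite (qform_lorentz_vec (psd_sym psdX)) => /eqP.
by rewrite mulrn_eq0 => /eqP.
Qed.

(** The motion A (1 + t D), (1 + t D)^-1 B with D = H J has product M, and the
    derivative of the Lorentz form at a singular factor is 2 H at A i and -2 H
    at the contact point of B j. So all factors become positive definite for
    small t > 0. *)
Lemma near_M32_of_strict (H : 'M[R]_3) :
  (forall i, \det (A i) = 0 -> 0 < qform H (vec (A i))) ->
  (forall j, \det (B j) = 0 -> qform H (vec (B j) *m J) < 0) ->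
  \forall N \near M, \rank N = 3%N -> M32 N.
Proof.
move=> HA HB; pose D := H *m J; pose T (t : R) := 1%:M + t *: D.
have t0 : (t @[t --> 0^'+] --> (0 : R))%classic.
  exact: cvg_at_right_filter cvg_id.
have T0 : mxcvg (0^'+)%classic T 1%:M.
  by rewrite -[X in mxcvg _ _ X]addr0 -(scale0r D);
    apply: mxcvgD (mxcvg_cst _) (mxcvgZ t0 (mxcvg_cst D)).
have unitT := near_unitmx T0 (unitmx1 _ _).
have nearA i : \forall t \near (0^'+)%classic,
    in_open_cone (row i (rows A *m T t)).
  have near0 : \forall t \near (0^'+)%classic,
      in_open_cone (vec (A i) + t *: (vec (A i) *m D)).
    apply: near_enter_cone (mxcvg_cst _); first exact: trace_left_gt0.
      exact: qform_psd_ge0 (left_factor_psd i).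
    move=> /(qform_psd_eq0 (left_factor_psd i))/HA.
    rewrite /D 2!trmx_mul tr_lorentz !mulmxA mul_lorentzK -qform_tr.
    by rewrite /qform.
  apply: filterS near0 => t.
  by rewrite row_mul row_rows mulmxDr mulmx1 -scalemxAr.
pose V t := invmx (T t) *m cols B.
have limV : mxcvg (0^'+)%classic V (cols B).
  rewrite -[X in mxcvg _ _ X]mul1mx -(invmx1 _ 3).
  exact: mxcvgM (mxcvg_inv T0 (unitmx1 _ _)) (mxcvg_cst _).
have nearB j : \forall t \near (0^'+)%classic, in_open_cone (row j (V t)^T).
  have rowB : row j (cols B)^T = vec (B j) by rewrite -tr_col tr_col_cols.
  pose z t := row j (V t)^T *m (- D^T).
  have limz : mxcvg (0^'+)%classic z (vec (B j) *m (- D^T)).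
    by rewrite -rowB; exact: mxcvgM (mxcvg_row (mxcvg_tr limV)) (mxcvg_cst _).
  have near0 : \forall t \near (0^'+)%classic,
      in_open_cone (vec (B j) + t *: z t).
    apply: near_enter_cone limz; first exact: trace_right_gt0.
      exact: qform_psd_ge0 (right_factor_psd j).
    move=> /(qform_psd_eq0 (right_factor_psd j))/HB; rewrite -oppr_gt0.
    congr (0 < _); rewrite /qform /D mulmxN linearN /= mulmxN [RHS]mxE.
    by rewrite !trmx_mul !trmxK tr_lorentz !mulmxA.
  near=> t.
  suff -> : row j (V t)^T = vec (B j) + t *: z t by near: t.
  have unitTt : T t \in unitmx by near: t; exact: unitT.
  have TV : T t *m V t = cols B by rewrite mulKVmx.
  rewrite -rowB -TV [(_ *m V t)^T]trmx_mul row_mul /T linearD /= trmx1 linearZ /=.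
  by rewrite mulmxDr mulmx1 -scalemxAr /z mulmxN scalerN addrK.
have [t [[unitTt At] Bt]] : exists t, ((T t \in unitmx) /\
    forall i, in_open_cone (row i (rows A *m T t))) /\
    forall j, in_open_cone (row j (V t)^T).
  apply: (@filter_ex _ (0^'+)%classic); apply: filterI.
    by apply: filterI; [exact: unitT|exact: filter_forall nearA].
  exact: filter_forall nearB.
apply: near_M32 rkM _ At Bt.
by rewrite /V mulmxA mulmxK // -(factorizationE fM).
Unshelve. all: by end_near. Qed.
End Boundary.
(** * Quadratic forms on the conic of rank-one psd matrices *)

Lemma poly_interpolation (K : fieldType) (s : K -> K) (rs : seq K) : uniq rs ->
  exists2 g : {poly K}, (size g <= size rs)%N & forall r, r \in rs -> g.[r] = s r.
Proof.
elim: rs => [|x rs IH] /= => [_|/andP[x_rs /IH[g size_g g_rs]]].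
  by exists 0; rewrite ?size_poly0.
pose P : {poly K} := \prod_(y <- rs) ('X - y%:P).
have Px : P.[x] != 0 by rewrite -[_ == _]/(root P x) root_prod_XsubC.
exists (g + ((s x - g.[x]) / P.[x]) *: P).
  rewrite (leq_trans (size_polyD _ _)) // geq_max (leqW size_g) /=.
  by rewrite (leq_trans (size_scale_leq _ _)) // size_prod_XsubC.
move=> r; rewrite in_cons hornerD hornerZ => /orP[/eqP->|r_rs].
  by rewrite mulfVK // addrC subrK.
have /rootP -> : root P r by rewrite root_prod_XsubC.
by rewrite mulr0 addr0 g_rs.
Qed.

(** Prescribing g at the finite roots of f together with its coefficient of
    degree 4, the value at infinity, is always possible: f has at most four
    finite roots, so a cubic correction of c X^4 does it. *)
Lemma quartic_interpolation (K : fieldType) (f : {poly K}) (s : K -> K) (c : K)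
    (rs : seq K) : f != 0 -> (size f <= 5)%N ->
  exists2 g : {poly K}, (size g <= 5)%N /\ g`_4 = c &
    forall r, r \in rs -> root f r -> g.[r] = s r.
Proof.
move=> f_neq0 size_f; pose zs := undup [seq r <- rs | root f r].
have size_zs : (size zs <= 4)%N.
  rewrite -ltnS (leq_trans _ size_f) //; apply: max_poly_roots => //.
    by apply/allP => r; rewrite mem_undup mem_filter => /andP[].
  exact: undup_uniq.
have [g size_g gE] := poly_interpolation (fun r => s r - c * r ^+ 4)
  (undup_uniq [seq r <- rs | root f r]).
have size_g4 : (size g <= 4)%N by exact: leq_trans size_g size_zs.
exists (g + c *: 'X^4).
  split; last first.
    by rewrite coefD coefZ coefXn (nth_default _ size_g4) add0r mulr1.
  rewrite (leq_trans (size_polyD _ _)) // geq_max (leqW size_g4) /=.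
  by rewrite (leq_trans (size_scale_leq _ _)) // size_polyXn.
move=> r r_rs fr; rewrite hornerD hornerZ hornerXn gE ?subrK //.
by rewrite mem_undup mem_filter fr.
Qed.

Section Conic.
Context {R : realType}.
Implicit Types (X Y : 'M[R]_2) (H : 'M[R]_3) (g : {poly R}).
Local Notation s2 := (Num.sqrt 2 : R).

(** The vector of the rank-one matrix with entries a^2, ab, b^2. *)
Definition conic (a b : R) : 'rV[R]_3 :=
  \row_(c < 3) [:: a ^+ 2; b ^+ 2; s2 * (a * b)]`_c.

(** The restriction of H to the conic, in the chart a = 1; the value at the
    point at infinity (0, 1) is the coefficient of degree 4. *)
Definition quartic H : {poly R} :=
  Poly [:: H 0 0; s2 * (H 0 2 + H 2 0); H 0 1 + H 1 0 + H 2 2 *+ 2;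
           s2 * (H 1 2 + H 2 1); H 1 1].

(** A section of [quartic]: every binary quartic is the restriction of a
    quadratic form. *)
Definition form_of g : 'M[R]_3 :=
  \matrix_(i < 3, j < 3) nth 0 (nth [::] [::
    [:: g`_0; g`_2; s2^-1 * g`_1];
    [:: 0; g`_4; s2^-1 * g`_3]; [:: 0; 0; 0]] i) j.

Lemma size_quartic H : (size (quartic H) <= 5)%N.
Proof. exact: size_Poly. Qed.

Lemma qform_conic1 H t : qform H (conic 1 t) = (quartic H).[t].
Proof.
have s2sq x : (s2 * x) ^+ 2 = 2 * x ^+ 2 by rewrite exprMn [s2 ^+ 2]expr2 sqrt2K.
rewrite horner_Poly qformE !mxE /= s2sq; ring.
Qed.

Lemma qform_conic01 H : qform H (conic 0 1) = (quartic H)`_4.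
Proof. by rewrite coef_Poly qformE !mxE /=; ring. Qed.

Lemma quartic_form_of g : (size g <= 5)%N -> quartic (form_of g) = g.
Proof.
move=> size_g; apply/polyP => k; rewrite coef_Poly.
have s2V x : s2 * (s2^-1 * x) = x by rewrite mulrA mulfV ?mul1r // sqrt2_neq0.
case: k => [|[|[|[|[|k]]]]]; rewrite !mxE /= ?addr0 ?mul0rn ?addr0 ?s2V //.
by rewrite nth_nil (leq_sizeP _ _ size_g).
Qed.

(** The quadratic forms vanishing on the conic are the multiples of its
    equation; H is only determined up to its antisymmetric part. *)
Lemma quartic0 H : quartic H = 0 -> exists c, H + H^T = c *: lorentz R.
Proof.
move=> H0; have coef k := congr1 (fun g : {poly R} => g`_k) H0.
have := (coef 0%N, coef 1%N, coef 2, coef 3, coef 4); rewrite !coef_Poly !coef0 /=.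
move=> [[[[h00 /eqP h02] h01] /eqP h12] h11].
move: h02 h12; rewrite !mulf_eq0 (negPf sqrt2_neq0) /= => /eqP h02 /eqP h12.
exists (H 0 1 + H 1 0).
apply/matrixP; apply: forall_ord3; apply: forall_ord3; rewrite !mxE /=; lra.
Qed.

(** The affine coordinate of a rank-one matrix on the conic. *)
Definition slope X : R := X 0 1 / X 0 0.

Lemma vec_slope X : psd X -> \det X = 0 -> X 0 0 != 0 ->
  vec X = X 0 0 *: conic 1 (slope X).
Proof.
move=> /psd_sym/symE X10; rewrite det2 X10 => Xd X0.
apply/rowP; apply: forall_ord3; rewrite !mxE /= /slope.
- by rewrite expr1n mulr1.
- apply: (mulfI X0).
  rewrite (_ : _ * (_ * _) = X 0 1 ^+ 2); last by field.
  by rewrite expr2; lra.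
- by rewrite mul1r; field.
Qed.

Lemma vec_infinity X : psd X -> X 0 0 = 0 -> vec X = X 1 1 *: conic 0 1.
Proof.
move=> psdX X0; have X01 := psd_offdiag0 psdX (or_introl X0).
apply/rowP; apply: forall_ord3; rewrite !mxE /= ?X0 ?X01; ring.
Qed.

Lemma qform_slope H X : psd X -> \det X = 0 -> X 0 0 != 0 ->
  qform H (vec X) = X 0 0 ^+ 2 * (quartic H).[slope X].
Proof.
move=> psdX Xd X0; rewrite vec_slope // -qform_conic1 !qformE !mxE; ring.
Qed.

Lemma qform_infinity H X : psd X -> X 0 0 = 0 ->
  qform H (vec X) = X 1 1 ^+ 2 * (quartic H)`_4.
Proof.
move=> psdX X0; rewrite vec_infinity // -qform_conic01 !qformE !mxE; ring.
Qed.

Lemma adj2E X : ((\adj X 0 0 = X 1 1)%R * (\adj X 1 1 = X 0 0)%R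
  * (\adj X 0 1 = - X 0 1)%R * (\adj X 1 0 = - X 1 0)%R)%type.
Proof.
have l0 : lift 0 0 = 1 :> 'I_2 by apply: val_inj.
have l1 : lift 1 0 = 0 :> 'I_2 by apply: val_inj.
rewrite !mxE /cofactor !det_mx11 !mxE /= l0 l1.
by rewrite !(expr0, expr1, mul1r, mulN1r, addn0, add0n, sqrrN, expr1n).
Qed.

Lemma vec_adj X : vec X *m lorentz R = vec (\adj X).
Proof.
apply/rowP; apply: forall_ord3; rewrite [LHS]mxE big_ord3 !vecE !adj2E !mxE /=;
  ring.
Qed.

Lemma psd_adj X : psd X -> psd (\adj X).
Proof.
move=> psdX; have X10 := symE (psd_sym psdX); have [X0 X1 Xd] := psd_ge0 psdX.
apply/psdP.
  apply/matrixP; apply: forall_ord2; apply: forall_ord2;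
  by rewrite [LHS]mxE ?adj2E ?X10.
rewrite det2 !adj2E; split=> //; move: Xd; rewrite det2; lra.
Qed.

Lemma det_adj2 X : \det (\adj X) = \det X.
Proof. rewrite !det2 !adj2E; ring. Qed.

Lemma tr_mul_adj X Y : psd X -> psd Y ->
  \tr (X *m Y) = X 0 0 * \adj Y 1 1 + X 1 1 * \adj Y 0 0
                 - X 0 1 * \adj Y 0 1 *+ 2.
Proof.
move=> /psd_sym/symE X10 /psd_sym/symE Y10.
rewrite !adj2E /mxtrace big_ord2 !mxE !big_ord2 X10 Y10; ring.
Qed.

(** If the contact points of two singular factors coincide, the factors are
    orthogonal; so in a positive matrix they never do. *)
Lemma tr0_same_slope X Y : psd X -> psd Y -> \det X = 0 -> \det Y = 0 ->
  X 0 0 != 0 -> \adj Y 0 0 != 0 -> slope X = slope (\adj Y) ->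
  \tr (X *m Y) = 0.
Proof.
move=> psdX psdY Xd Yd X0 Y0; have psdY' := psd_adj psdY.
rewrite tr_mul_adj // /slope; have /symE X10 := psd_sym psdX.
have /symE Y10 := psd_sym psdY'; move: Xd Yd; rewrite -(det_adj2 Y) !det2 X10 Y10.
move: X0 Y0; move: (X 0 0) (X 0 1) (X 1 1) (\adj Y 0 0) (\adj Y 0 1) (\adj Y 1 1).
move=> a b c u v w a0 u0 d1 d2 e.
have -> : c = b * b / a by apply: (mulfI a0); rewrite mulrCA mulfV //; lra.
have -> : w = v * v / u by apply: (mulfI u0); rewrite mulrCA mulfV //; lra.
have -> : b = a * (v / u) by rewrite -e; field.
by field; apply/andP.
Qed.

Lemma tr0_infinity X Y : psd X -> psd Y -> X 0 0 = 0 -> \adj Y 0 0 = 0 ->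
  \tr (X *m Y) = 0.
Proof.
move=> psdX psdY X0 Y0; rewrite tr_mul_adj // X0 Y0.
rewrite (psd_offdiag0 psdX (or_introl X0)); ring.
Qed.

End Conic.

(** * Forms that weakly separate the contacts *)

Section Rigidity.
Context {R : realType} {p q : nat} {M : 'M[R]_(p, q)}.
Context {A : 'I_p -> 'M[R]_2} {B : 'I_q -> 'M[R]_2}.
Hypothesis M_gt0 : forall i j, 0 < M i j.
Hypothesis M_boundary : boundary_M32 M.
Hypothesis fM : psd_factorization M A B.
Local Notation J := (lorentz R).

Let rkM : \rank M = 3%N := boundary_rank3 M_boundary.
Let psdA i : psd (A i) := left_factor_psd fM i.
Let psdB j : psd (B j) := right_factor_psd fM j.
Let psdB' j : psd (\adj (B j)) := psd_adj (psdB j).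

Lemma tr_AB_neq0 i j : \tr (A i *m B j) <> 0.
Proof. by case: fM => _ _ <- M0; have := M_gt0 i j; rewrite M0 ltxx. Qed.

Lemma A11_neq0 i : A i 0 0 = 0 -> A i 1 1 != 0.
Proof. by have := trace_left_gt0 M_gt0 rkM fM i; rewrite !vecE; lra. Qed.

Lemma adjB11_neq0 j : \adj (B j) 0 0 = 0 -> \adj (B j) 1 1 != 0.
Proof. by have := trace_right_gt0 M_gt0 rkM fM j; rewrite !vecE !adj2E; lra. Qed.

Lemma adjB_neq0 j : \adj (B j) != 0.
Proof.
apply/eqP => B0; have := @adjB11_neq0 j.
by rewrite B0 !mxE eqxx => /(_ erefl).
Qed.

Lemma sqr_mul_gt0 (x y : R) : x != 0 -> 0 < y -> 0 < x ^+ 2 * y.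
Proof. by move=> x0; rewrite pmulr_rgt0 // exprn_even_gt0. Qed.

(** H restricted to the conic has at most four roots, and a contact of some A
    i is never a contact of some B j; a quartic therefore takes the value 1 at
    the roots of the first kind and -1 at those of the second kind. *)
Lemma separating_form (H : 'M[R]_3) : quartic H != 0 ->
  exists G : 'M[R]_3,
    (forall i, \det (A i) = 0 -> qform H (vec (A i)) = 0 ->
       0 < qform G (vec (A i))) /\
    (forall j, \det (B j) = 0 -> qform H (vec (B j) *m J) = 0 ->
       qform G (vec (B j) *m J) < 0).
Proof.
move=> H_neq0.
pose onA r := [exists i, [&& \det (A i) == 0, A i 0 0 != 0 & slope (A i) == r]].
pose infA := [exists i, (\det (A i) == 0) && (A i 0 0 == 0)].
pose rs := [seq slope (A i) | i <- enum 'I_p] ++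
           [seq slope (\adj (B j)) | j <- enum 'I_q].
have [g [size_g g4] g_rs] := quartic_interpolation
  (fun r => if onA r then 1 else -1) (if infA then 1 else -1) rs H_neq0
  (size_quartic H).
exists (form_of g); split=> [i Ad|j Bd].
  have [A0|A0] := eqVneq (A i 0 0) 0.
    move=> _; rewrite qform_infinity // quartic_form_of // g4.
    apply: sqr_mul_gt0; first exact: A11_neq0.
    rewrite ifT //; apply/existsP; exists i; by rewrite Ad A0 !eqxx.
  rewrite !qform_slope // quartic_form_of // => /eqP.
  rewrite mulf_eq0 sqrf_eq0 (negPf A0) /= => H0.
  apply: sqr_mul_gt0 => //; rewrite g_rs //.
    by rewrite ifT //; apply/existsP; exists i; rewrite Ad A0 !eqxx.
  rewrite mem_cat; apply/orP; left.
  by apply: (map_f (fun i => slope (A i))); rewrite mem_enum.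
have B'd : \det (\adj (B j)) = 0 by rewrite det_adj2.
rewrite vec_adj -oppr_gt0; have [B0|B0] := eqVneq (\adj (B j) 0 0) 0.
  move=> _; rewrite qform_infinity // quartic_form_of // g4 -mulrN.
  apply: sqr_mul_gt0; first exact: adjB11_neq0.
  rewrite ifF ?opprK //; apply/existsP => -[i /andP[/eqP Ad /eqP A0]].
  exact: tr_AB_neq0 (tr0_infinity (psdA i) (psdB j) A0 B0).
rewrite !qform_slope // quartic_form_of // => /eqP.
rewrite mulf_eq0 sqrf_eq0 (negPf B0) /= => H0; rewrite -mulrN.
apply: sqr_mul_gt0 => //; rewrite g_rs //.
  rewrite ifF ?opprK //; apply/existsP => -[i /and3P[/eqP Ad A0 /eqP AB]].
  exact: tr_AB_neq0 (tr0_same_slope (psdA i) (psdB j) Ad Bd A0 B0 AB).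
rewrite mem_cat; apply/orP; right.
by apply: (map_f (fun j => slope (\adj (B j)))); rewrite mem_enum.
Qed.

(** Otherwise H + e G, with G the separating form and e > 0 small, is strictly
    positive at the contacts of A and strictly negative at those of B, and M
    is an interior point. *)
Lemma weak_separation_trivial (H : 'M[R]_3) :
  (forall i, \det (A i) = 0 -> 0 <= qform H (vec (A i))) ->
  (forall j, \det (B j) = 0 -> qform H (vec (B j) *m J) <= 0) ->
  exists c, H + H^T = c *: J.
Proof.
move=> HA HB; have [|H_neq0] := eqVneq (quartic H) 0; first exact: quartic0.
have [G [GA GB]] := separating_form H_neq0.
have pert (x y : R) : 0 <= x -> (x = 0 -> 0 < y) ->
    \forall e \near (0^'+)%classic, 0 < x + e * y.
  move=> x_ge0 xy; have [x0|x_neq0] := eqVneq x 0.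
    apply: filterS (nbhs_right_gt 0) => e e_gt0.
    by rewrite x0 add0r mulr_gt0 ?xy.
  have lim : (x + e * y @[e --> 0^'+] --> x + 0 * y)%classic.
    apply: cvgD; first exact: cvg_cst.
    apply: cvgM; last exact: cvg_cst.
    exact: cvg_at_right_filter cvg_id.
  by apply: cvgr_gt lim _ _; rewrite mul0r addr0 lt_def x_neq0.
have nearA i : \forall e \near (0^'+)%classic,
    \det (A i) = 0 -> 0 < qform (H + e *: G) (vec (A i)).
  have [Ad|Ad] := eqVneq (\det (A i)) 0; last first.
    by apply: nearW => e Ad0; rewrite Ad0 eqxx in Ad.
  by apply: filterS (pert _ _ (HA i Ad) (GA i Ad)) => e; rewrite qformD qformZ.
have nearB j : \forall e \near (0^'+)%classic,
    \det (B j) = 0 -> qform (H + e *: G) (vec (B j) *m J) < 0.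
  have [Bd|Bd] := eqVneq (\det (B j)) 0; last first.
    by apply: nearW => e Bd0; rewrite Bd0 eqxx in Bd.
  have HBj : 0 <= - qform H (vec (B j) *m J) by rewrite oppr_ge0 HB.
  have GBj : - qform H (vec (B j) *m J) = 0 -> 0 < - qform G (vec (B j) *m J).
    by move=> /eqP; rewrite oppr_eq0 oppr_gt0 => /eqP; apply: GB.
  apply: filterS (pert _ _ HBj GBj) => e e_pos _.
  by rewrite qformD qformZ; lra.
have [e [Ae Be]] := filter_ex
  (filterI (filter_forall _ nearA) (filter_forall _ nearB)).
by have := boundary_not_near M_boundary (near_M32_of_strict M_gt0 rkM fM Ae Be).
Qed.

End Rigidity.
(** * Infinitesimal motions in coordinates *)

Lemma principal_minor1 (K : comNzRingType) n (X : 'M[K]_n) (k : 'I_n) :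
  principal_minor [set k]%SET X = X k k.
Proof.
rewrite /principal_minor; set e := enum_val; have : forall a, e a = k.
  by move=> a; apply/set1P; apply: enum_valP.
move: e; rewrite cards1 => e ek.
by rewrite det_mx11 mxE !ek.
Qed.

Lemma det2_reindex (K : comNzRingType) (X : 'M[K]_2) (e : 'I_2 -> 'I_2) :
  injective e -> \det (mxsub e e X) = \det X.
Proof.
move=> e_inj; rewrite !det2 !mxE.
have : e 0 != e 1 by rewrite (inj_eq e_inj).
by move: (e 0) (e 1); apply: forall_ord2; apply: forall_ord2 => // _; ring.
Qed.

Lemma principal_minorT (K : comNzRingType) (X : 'M[K]_2) :
  principal_minor [set: 'I_2]%SET X = \det X.
Proof.
rewrite /principal_minor; have := @enum_val_inj _ [set: 'I_2]%SET; move: enum_val.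
rewrite cardsT card_ord => e; exact: det2_reindex.
Qed.

Lemma ord2_setP (I : {set 'I_2}) : I != finset.set0 ->
  [\/ I = [set 0]%SET, I = [set 1]%SET | I = [set: 'I_2]%SET].
Proof.
case/set0Pn => k kI; case I0 : (0 \in I); case I1 : (1 \in I).
- by constructor 3; apply/setP; apply: forall_ord2; rewrite inE ?I0 ?I1.
- by constructor 1; apply/setP; apply: forall_ord2; rewrite !inE ?I0 ?I1.
- by constructor 2; apply/setP; apply: forall_ord2; rewrite !inE ?I0 ?I1.
- by move: k kI; apply: forall_ord2; rewrite ?I0 ?I1.
Qed.

Section Motions.
Context {R : realType}.
Implicit Types (X Y : 'M[R]_2) (D : 'M[R]_3) (s : nat) (t : R).
Local Notation J := (lorentz R).

Lemma horner_taylor s (f : {poly R}) t :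
  (taylor s f).[t] = \sum_(i < s.+1) f`_i * t ^+ i.
Proof.
rewrite /taylor horner_sum; apply: eq_bigr => i _.
by rewrite hornerZ hornerXn horner_coef0 coef_nderivn addn0 binn mulr1n.
Qed.

Lemma coef_minor1 (X Y : 'M[R]_2) k i :
  (minor_along [set k]%SET X Y)`_i = [:: X k k; Y k k]`_i.
Proof.
rewrite /minor_along principal_minor1 !mxE coefD coefC coefXM coefC.
by case: i => [|[|i]] /=; rewrite ?addr0 ?add0r ?nth_nil.
Qed.

(** The polar form of the determinant: the coefficient of t in \det (X + t Y).
    *)
Definition polar X Y : R := (vec X *m J *m (vec Y)^T) 0 0.

Lemma polarE X Y :
  polar X Y = X 0 0 * Y 1 1 + X 1 1 * Y 0 0 - X 0 1 * Y 0 1 *+ 2.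
Proof.
rewrite /polar !mxE !big_ord3 !mxE !big_ord3 !mxE /=.
transitivity (X 0 0 * Y 1 1 + X 1 1 * Y 0 0
  - Num.sqrt 2 * Num.sqrt 2 * (X 0 1 * Y 0 1)); first ring.
rewrite sqrt2K; ring.
Qed.

Lemma coef_minorT X Y i : X^T = X -> Y^T = Y ->
  (minor_along [set: 'I_2]%SET X Y)`_i = [:: \det X; polar X Y; \det Y]`_i.
Proof.
move=> symX symY; have -> : minor_along [set: 'I_2]%SET X Y
    = Poly [:: \det X; polar X Y; \det Y]; last by rewrite coef_Poly.
rewrite /minor_along principal_minorT polarE !det2 !mxE.
rewrite (symE symX) (symE symY) /=.
rewrite !cons_poly_def mul0r add0r !(polyCD, polyCN, polyCM, polyCMn); ring.
Qed.

(** The minors are truncated at order s, so for s = 1 the matrix X + t Y itself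
    may leave the psd cone. *)
Definition stays_psd s X Y t : Prop :=
  forall I : {set 'I_2}, I != finset.set0 ->
    0 <= (taylor s (minor_along I X Y)).[t].

Lemma right_slope_ge0 (b c e : R) : 0 < e ->
  (forall t, 0 <= t -> t < e -> 0 <= b * t + c * t ^+ 2) -> 0 <= b.
Proof.
move=> e_gt0 bc_ge0; rewrite leNgt; apply/negP => b_lt0.
pose t := Num.min (e / 2) (- b / (2 * (`|c| + 1))).
have c1 : 0 < `|c| + 1 by rewrite ltr_wpDl.
have t_gt0 : 0 < t by rewrite lt_min !divr_gt0 ?mulr_gt0 ?oppr_gt0.
have t_lt : t < e by rewrite gt_min; apply/orP; left; lra.
have := bc_ge0 t (ltW t_gt0) t_lt.
have -> : b * t + c * t ^+ 2 = t * (b + c * t) by ring.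
rewrite pmulr_rge0 // leNgt; apply/negP; rewrite negbK.
have t_le : t * (2 * (`|c| + 1)) <= - b.
  by rewrite -ler_pdivlMr ?mulr_gt0 // ge_min lexx orbT.
have := ler_wpM2r (ltW t_gt0) (ler_norm c); nra.
Qed.

Lemma stays_psd_slope s X Y e : (s == 1%N) || (s == 2) ->
  X^T = X -> Y^T = Y -> \det X = 0 -> 0 < e ->
  (forall t, 0 <= t -> t < e -> stays_psd s X Y t) ->
  0 <= polar X Y /\ (s = 2 -> polar X Y = 0 -> 0 <= \det Y).
Proof.
move=> s12 symX symY Xd e_gt0 XY.
have T_neq0 : [set: 'I_2]%SET != finset.set0 by apply/set0Pn; exists 0; rewrite inE.
have {}XY t : 0 <= t -> t < e ->
    0 <= polar X Y * t + (if s == 2 then \det Y else 0) * t ^+ 2.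
  move=> t0 te; have := XY t t0 te _ T_neq0; rewrite horner_taylor.
  case/orP: s12 => /eqP -> /=; rewrite !big_ord_recl big_ord0 !coef_minorT //= Xd.
    by rewrite !mul0r !add0r !addr0 expr1.
  by rewrite !mul0r !add0r !addr0 expr1.
split; first exact: right_slope_ge0 e_gt0 XY.
move=> s2 XY0; move: XY; rewrite s2 /= XY0 => XY.
have e2_gt0 : 0 < e / 2 by rewrite divr_gt0.
have e2_lt : e / 2 < e by lra.
have := XY _ (ltW e2_gt0) e2_lt.
by rewrite mul0r add0r pmulr_lge0 // exprn_gt0.
Qed.

Lemma near_affine_ge0 (a b : R) : 0 <= a -> (a = 0 -> 0 <= b) ->
  \forall t \near (0 : R), 0 <= t -> 0 <= a + b * t.
Proof.
move=> a_ge0 ab; have [a0|a_neq0] := eqVneq a 0.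
  by apply: filterE => t t_ge0; rewrite a0 add0r mulr_ge0 ?ab.
have lim : (a + b * t @[t --> (0 : R)] --> a + b * 0)%classic.
  by apply: cvgD; [exact: cvg_cst|apply: cvgM; [exact: cvg_cst|exact: cvg_id]].
have : \forall t \near (0 : R), 0 < a + b * t.
  by apply: cvgr_gt lim _ _; rewrite mulr0 addr0 lt_def a_neq0.
by apply: filterS => t /ltW.
Qed.

(** The case needing care is a vanishing diagonal entry: then the determinant
    vanishes, hence also its derivative, and that derivative is a product of
    the other diagonal entry with the derivative in question. *)
Lemma stays_psd1 X Y (c : R) : psd X -> Y^T = Y -> polar X Y = c * \det X ->
  (X = 0 -> Y = 0) -> \forall t \near (0 : R), 0 <= t -> stays_psd 1 X Y t.
Proof.
move=> psdX symY XY X0Y0; have symX := psd_sym psdX.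
have [X0 X1 Xd] := psd_ge0 psdX.
have diag0 : X 0 0 = 0 -> 0 <= Y 0 0.
  move=> X00; have X01 := psd_offdiag0 psdX (or_introl X00).
  have [X11|X11] := eqVneq (X 1 1) 0.
    by rewrite X0Y0 ?mxE //; apply: psd_eq0 => //; rewrite X00 X11 addr0.
  move: XY; rewrite polarE det2 (symE symX) X00 X01 !mul0r mul0rn !subr0.
  rewrite add0r mulr0 => /eqP; rewrite mulf_eq0 (negPf X11) /= => /eqP ->.
  exact: lexx.
have diag1 : X 1 1 = 0 -> 0 <= Y 1 1.
  move=> X11; have X01 := psd_offdiag0 psdX (or_intror X11).
  have [X00|X00] := eqVneq (X 0 0) 0.
    by rewrite X0Y0 ?mxE //; apply: psd_eq0 => //; rewrite X00 X11 addr0.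
  move: XY; rewrite polarE det2 (symE symX) X11 X01 !mul0r mul0rn mulr0 !subr0.
  rewrite addr0 mulr0 => /eqP; rewrite mulf_eq0 (negPf X00) /= => /eqP ->.
  exact: lexx.
have minor_ge0 : \det X = 0 -> 0 <= polar X Y by move=> Xd0; rewrite XY Xd0 mulr0.
near=> t => t_ge0 I /ord2_setP I_cases; rewrite horner_taylor.
rewrite !big_ord_recl big_ord0 addr0 expr0 mulr1 expr1.
case: I_cases => ->; rewrite ?coef_minorT // ?coef_minor1 /=.
- by move: t_ge0; near: t; exact: near_affine_ge0.
- by move: t_ge0; near: t; exact: near_affine_ge0.
- by move: t_ge0; near: t; exact: near_affine_ge0.
Unshelve. all: by end_near. Qed.

Lemma stays_psd2_scale X (c : R) : psd X ->
  \forall t \near (0 : R), 0 <= t -> stays_psd 2 X (c *: X) t.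
Proof.
move=> psdX; have [X0 X1 Xd] := psd_ge0 psdX; have symX := psd_sym psdX.
have sym_cX : (c *: X)^T = c *: X by rewrite linearZ /= symX.
have near1 : \forall t \near (0 : R), 0 <= t -> 0 <= 1 + c * t.
  by apply: near_affine_ge0 => // /eqP; rewrite oner_eq0.
apply: filterS near1 => t ct_ge0 /ct_ge0 {}ct_ge0 I /ord2_setP I_cases.
rewrite horner_taylor !big_ord_recl big_ord0 addr0 expr0 mulr1 expr1.
case: I_cases => ->; rewrite ?coef_minorT // ?coef_minor1 /=.
- rewrite mxE mul0r addr0 (_ : _ + _ = X 0 0 * (1 + c * t)); last ring.
  exact: mulr_ge0.
- rewrite mxE mul0r addr0 (_ : _ + _ = X 1 1 * (1 + c * t)); last ring.
  exact: mulr_ge0.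
rewrite (_ : _ + _ = \det X * (1 + c * t) ^+ 2).
  by apply: mulr_ge0 => //; exact: sqr_ge0.
rewrite polarE !det2 !mxE (symE symX); ring.
Qed.

End Motions.

(** * Infinitesimal rigidity *)

Section MovedFactorizations.
Context {R : realType} {p q : nat}.
Implicit Types (E : 'I_p -> 'M[R]_2) (F : 'I_q -> 'M[R]_2) (D : 'M[R]_3).
Local Notation J := (lorentz R).

Definition moveA D E i : 'M[R]_2 := unvec (vec (E i) *m D).
Definition moveB D F j : 'M[R]_2 := unvec (- (vec (F j) *m D^T)).

Lemma move_given_by D E F : motion_given_by D E F (moveA D E) (moveB D F).
Proof. by split=> k; rewrite unvecK // linearN /= trmx_mul trmxK. Qed.

Lemma inf_motion_move s D E F :
  (forall i, (E i)^T = E i) -> (forall j, (F j)^T = F j) ->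
  (forall i, \forall t \near (0 : R), 0 <= t -> stays_psd s (E i) (moveA D E i) t) ->
  (forall j, \forall t \near (0 : R), 0 <= t -> stays_psd s (F j) (moveB D F j) t) ->
  inf_motion s E F (moveA D E) (moveB D F).
Proof.
move=> symE symF nearE nearF; split.
- by split=> k; apply: tr_unvec.
- move=> i j; rewrite !tr_mul_vec ?tr_unvec // !unvecK.
  rewrite linearN /= trmx_mul trmxK mulmxN mulmxA [X in _ + X]mxE.
  exact: subrr.
have /nbhs_ballP[e e_gt0 eP] : \forall t \near (0 : R),
    (forall i, 0 <= t -> stays_psd s (E i) (moveA D E i) t) /\
    (forall j, 0 <= t -> stays_psd s (F j) (moveB D F j) t).
  by apply: filterI; [exact: filter_forall nearE|exact: filter_forall nearF].
exists e => // t t_ge0 te I I_neq0.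
have [|Et Ft] := eP t.
  by rewrite /ball /= sub0r normrN ger0_norm.
by split=> k; [apply: Et|apply: Ft].
Qed.

(** These D generate the similarities of the Lorentz form. To first order they
    multiply the determinant by 1 + c t on the left factors and by 1 - c t on
    the right ones, so a singular factor stays singular to first order. *)
Lemma inf_motion1_conformal D (c : R) (N : 'M[R]_(p, q)) E F :
  D *m J + J *m D^T = c *: J -> psd_factorization N E F ->
  inf_motion 1 E F (moveA D E) (moveB D F).
Proof.
move=> DJ [psdE psdF _].
have JD : J *m D + D^T *m J = c *: J.
  have := congr1 (fun X => J *m X *m J) DJ.
  rewrite -scalemxAr -scalemxAl mulmxDr mulmxDl !mulmxA mul_lorentz mul1mx.
  by rewrite mul1mx mul_lorentzK addrC.
have qDJ x : qform (D *m J) x = c / 2 * qform J x.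
  have := congr1 (fun H => qform H x) DJ.
  rewrite qformD qformZ -[J *m D^T]trmxK trmx_mul trmxK tr_lorentz qform_tr; lra.
have qJD x : qform (J *m D) x = c / 2 * qform J x.
  have := congr1 (fun H => qform H x) JD.
  rewrite qformD qformZ -[D^T *m J]trmxK trmx_mul trmxK tr_lorentz qform_tr; lra.
apply: inf_motion_move => [i|j|i|j]; try exact: psd_sym.
- apply: (@stays_psd1 _ _ _ c) => //; first exact: tr_unvec.
    rewrite /polar unvecK trmx_mul mulmxA -(mulmxA _ J) -/(qform _ _).
    rewrite -[J *m _]trmxK trmx_mul trmxK tr_lorentz qform_tr qDJ.
    by rewrite qform_lorentz_vec; [lra|exact: psd_sym].
  by move=> Ei0; rewrite /moveA Ei0 vec0 mul0mx unvec0.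
apply: (@stays_psd1 _ _ _ (- c)) => //; first exact: tr_unvec.
  rewrite /polar unvecK linearN /= trmx_mul trmxK mulmxN mulmxA -(mulmxA _ J).
  rewrite mxE -/(qform _ _) qJD.
  by rewrite qform_lorentz_vec; [lra|exact: psd_sym].
by move=> Fj0; rewrite /moveB Fj0 vec0 mul0mx oppr0 unvec0.
Qed.

(** Scalings multiply every minor by a power of 1 + c t, exactly. *)
Lemma inf_motion2_scale (c : R) (N : 'M[R]_(p, q)) E F :
  psd_factorization N E F ->
  inf_motion 2 E F (moveA c%:M E) (moveB c%:M F).
Proof.
move=> [psdE psdF _].
have AE i : moveA c%:M E i = c *: E i.
  have symEi := psd_sym (psdE i).
  apply: vec_inj; rewrite ?tr_unvec ?linearZ /= ?symEi // unvecK mul_mx_scalar.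
  by apply/rowP; apply: forall_ord3; rewrite !mxE /=; ring.
have BE j : moveB c%:M F j = (- c) *: F j.
  have symFj := psd_sym (psdF j).
  apply: vec_inj; rewrite ?tr_unvec ?linearZ /= ?symFj // unvecK tr_scalar_mx.
  rewrite mul_mx_scalar.
  by apply/rowP; apply: forall_ord3; rewrite !mxE /=; ring.
apply: inf_motion_move => [i|j|i|j]; try exact: psd_sym.
  by rewrite AE; apply: stays_psd2_scale.
by rewrite BE; apply: stays_psd2_scale.
Qed.

End MovedFactorizations.

Section RigidityOfBoundary.
Context {R : realType} {p q : nat} {M : 'M[R]_(p, q)}.
Context {A : 'I_p -> 'M[R]_2} {B : 'I_q -> 'M[R]_2}.
Hypothesis M_gt0 : forall i j, 0 < M i j.
Hypothesis M_boundary : boundary_M32 M.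
Hypothesis fM : psd_factorization M A B.
Local Notation J := (lorentz R).

Let rkM : \rank M = 3%N := boundary_rank3 M_boundary.
Let symA i : (A i)^T = A i := psd_sym (left_factor_psd fM i).
Let symB j : (B j)^T = B j := psd_sym (right_factor_psd fM j).

(** The equations say A' B + A B' = 0 for the matrices of the factors; D is
    read off from a right inverse of B. *)
Lemma motion_matrix A' B' :
  (forall i, (A' i)^T = A' i) -> (forall j, (B' j)^T = B' j) ->
  (forall i j, \tr (A' i *m B j) + \tr (A i *m B' j) = 0) ->
  exists D, motion_given_by D A B A' B'.
Proof.
move=> symA' symB' tr0.
have [/row_fullP[L LA] /row_freeP[W BW]] :=
  rank3_factors rkM (factorizationE fM).
have AB0 : rows A' *m cols B + rows A *m cols B' = 0.
  by apply/matrixP => i j; rewrite mxE !mul_rows_cols // tr0 mxE.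
pose D := - (cols B' *m W).
have A'D : rows A' = rows A *m D.
  rewrite /D mulmxN mulmxA -[LHS]mulmx1 -BW mulmxA; apply/eqP.
  by rewrite -addr_eq0 -mulmxDl AB0 mul0mx.
have B'D : cols B' = - (D *m cols B).
  rewrite -[LHS]mul1mx -[D *m _]mul1mx -LA -!mulmxA [rows A *m (D *m _)]mulmxA -A'D.
  by apply/eqP; rewrite -mulmxN -subr_eq0 -mulmxBr opprK addrC AB0 mulmx0.
exists D; split=> [i|j].
  by rewrite -row_rows A'D row_mul row_rows.
by rewrite -!tr_col_cols !trmxK B'D !colE mulNmx mulmxA.
Qed.

(** To first order the motion keeps the singular factors in the cone, so the
    form D J weakly separates the contacts. *)
Lemma motion_conformal s A' B' : (s == 1%N) || (s == 2) ->
  inf_motion s A B A' B' ->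
  exists D c, motion_given_by D A B A' B' /\ D *m J + J *m D^T = c *: J.
Proof.
move=> s12 [[symA' symB'] tr0 [e e_gt0 eP]].
have [D [DA DB]] := motion_matrix symA' symB' tr0; exists D.
suff [c DJ] : exists c, D *m J + (D *m J)^T = c *: J.
  by exists c; split=> //; rewrite -DJ trmx_mul tr_lorentz.
apply: (weak_separation_trivial M_gt0 M_boundary fM) => [i Ad|j Bd].
  have [|+ _] := stays_psd_slope s12 (symA i) (symA' i) Ad e_gt0.
    by move=> t t0 te I I0; case: (eP t t0 te I I0).
  rewrite /polar DA trmx_mul mulmxA -(mulmxA _ J) -/(qform _ _).
  by rewrite -[J *m _]trmxK trmx_mul trmxK tr_lorentz qform_tr.
have [|+ _] := stays_psd_slope s12 (symB j) (symB' j) Bd e_gt0.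
  by move=> t t0 te I I0; case: (eP t t0 te I I0).
rewrite /polar DB mulmxN mulmxA -(mulmxA _ J) mxE -/(qform _ _) oppr_ge0.
by rewrite qform_mul tr_lorentz -!mulmxA mul_lorentz mulmx1.
Qed.

Theorem boundary_rigid1 : inf_rigid 1 A B.
Proof.
move=> A' B' motion; have [//|D [c [DAB DJ]]] := motion_conformal _ motion.
exists D => // N E F _ fN; exists (moveA D E), (moveB D F).
by split; [exact: move_given_by|exact: inf_motion1_conformal DJ fN].
Qed.

(** The entries of J at (0, 0) and (1, 1) vanish, so N02 = N12 = 0; the entry
    at (2, 2) then gives k = 0, and the one at (0, 1) gives N01 = 0. *)
Lemma skew_null (N : 'M[R]_3) (k : R) : N^T = - N ->
  N *m J *m N^T = k *: J -> N = 0.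
Proof.
move=> /matrixP skew NJN.
have N00 : N 0 0 = 0 by have := skew 0 0; rewrite !mxE; lra.
have N11 : N 1 1 = 0 by have := skew 1 1; rewrite !mxE; lra.
have N22 : N 2 2 = 0 by have := skew 2 2; rewrite !mxE; lra.
have N10 : N 1 0 = - N 0 1 by have := skew 0 1; rewrite !mxE.
have N20 : N 2 0 = - N 0 2 by have := skew 0 2; rewrite !mxE.
have N21 : N 2 1 = - N 1 2 by have := skew 1 2; rewrite !mxE.
have ent (i j : 'I_3) : (N *m J *m N^T) i j = k * J i j by rewrite NJN mxE.
have := (ent 0 0, ent 1 1, ent 0 1, ent 2 2).
rewrite !mxE !big_ord3 !mxE !big_ord3 !mxE /= N00 N11 N22 N10 N20 N21.
move=> [[[e00 e11] e01] e22].
have N02 : N 0 2 = 0 by apply/eqP; rewrite -sqrf_eq0; apply/eqP; lra.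
have N12 : N 1 2 = 0 by apply/eqP; rewrite -sqrf_eq0; apply/eqP; lra.
move: e01 e22; rewrite N02 N12 => e01 e22.
have N01 : N 0 1 = 0 by apply/eqP; rewrite -sqrf_eq0; apply/eqP; lra.
apply/matrixP; apply: forall_ord3; apply: forall_ord3;
  by rewrite [RHS]mxE ?N00 ?N11 ?N22 ?N10 ?N20 ?N21 ?N01 ?N02 ?N12 ?oppr0.
Qed.

(** Write D J = N + (c / 2) J with N antisymmetric. At a singular factor the
    first derivative of the determinant vanishes, so the second-order term,
    the form N J N^T, is nonnegative at the contacts of A. It is nonpositive
    on the whole conic, since x N is orthogonal to x. Hence it weakly
    separates the contacts and is a multiple of J, which forces N = 0 and D
    scalar. *)
Theorem boundary_rigid2 : inf_rigid 2 A B.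
Proof.
move=> A' B' motion; have [//|D [c [[DA DB] DJ]]] := motion_conformal _ motion.
have [[symA' _] _ [e e_gt0 eP]] := motion.
pose N := D *m J - (c / 2) *: J.
have trN : N^T = J *m D^T - (c / 2) *: J.
  by rewrite linearB /= linearZ /= trmx_mul tr_lorentz.
have skewN : N^T = - N.
  apply/eqP; rewrite -addr_eq0 trN /N addrACA [_ + D *m J]addrC DJ -opprD -scalerDl.
  by rewrite -splitr subrr.
have DJD : D *m J *m D^T = N *m J *m N^T + (c ^+ 2 / 4) *: J.
  rewrite trN /N mulmxBl mul_lorentzK -scalemxAl mul_lorentz mulmxBr !mulmxBl.
  rewrite -!scalemxAl !mul1mx -!scalemxAr mulmxA.
  move: DJ; move: (D *m J *m D^T) (D *m J) (J *m D^T) => X Y Z YZ.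
  have -> : Z = c *: J - Y by rewrite -YZ addrC addKr.
  by apply/matrixP => i j; rewrite !mxE; field.
have qN x : qform J x = 0 -> qform (N *m J *m N^T) x = qform J (x *m D).
  by move=> x0; rewrite qform_mul DJD qformD qformZ x0 mulr0 addr0.
have [k NJN] : exists k, N *m J *m N^T + (N *m J *m N^T)^T = k *: J.
  apply: (weak_separation_trivial M_gt0 M_boundary fM) => [i Ad|j Bd].
    have [|slope_ge0 detA'] := stays_psd_slope (s := 2) isT (symA i) (symA' i) Ad e_gt0.
      by move=> t t0 te I I0; case: (eP t t0 te I I0).
    have q0 : qform J (vec (A i)) = 0 by rewrite qform_lorentz_vec // Ad mul0rn.
    rewrite qN // -DA qform_lorentz_vec // mulrn_wge0 // detA' //.
    rewrite /polar DA trmx_mul mulmxA -(mulmxA _ J) -/(qform _ _).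
    have := congr1 (fun H => qform H (vec (A i))) DJ.
    rewrite qformD qformZ q0 mulr0.
    rewrite -[J *m _]trmxK trmx_mul trmxK tr_lorentz qform_tr; lra.
  rewrite -qform_mul vec_adj -[X in qform J X]unvecK qform_lorentz_vec ?tr_unvec //.
  rewrite pmulrn_lle0 //.
  have psdB' := psd_adj (right_factor_psd fM j).
  apply: (det_le0_of_tr0 psdB'); rewrite ?tr_unvec //.
    exact: adjB_neq0 M_gt0 M_boundary fM _.
  rewrite tr_mul_vec ?tr_unvec ?(psd_sym psdB') // unvecK.
  rewrite trmx_mul mulmxA -/(qform _ _) skewN; have := qform_tr N (vec (\adj (B j))).
  by rewrite skewN -scaleN1r qformZ; lra.
have N0 : N = 0.
  apply: (@skew_null N (k / 2) skewN).
  move: NJN; rewrite !trmx_mul trmxK tr_lorentz mulmxA => NJN.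
  by rewrite mulrC -scalerA -NJN -mulr2n -scalerMnr scalerMnl -mulr_natr mulVf ?scale1r.
have Dc : D = (c / 2)%:M.
  have := congr1 (fun X => X *m J) N0.
  rewrite /N mulmxBl mul_lorentzK -scalemxAl mul_lorentz mul0mx scalemx1 => /eqP.
  by rewrite subr_eq0 => /eqP.
exists D => // Q E F _ fQ; exists (moveA D E), (moveB D F).
by split; [exact: move_given_by|rewrite Dc; exact: inf_motion2_scale fQ].
Qed.
End RigidityOfBoundary.
(** * Linear automorphisms of the Lorentz cone *)

Section Congruence.
Context {R : realType}.
Implicit Types (X Y S : 'M[R]_2) (T : 'M[R]_3).
Local Notation J := (lorentz R).

Definition mx2 (a b c d : R) : 'M[R]_2 :=
  \matrix_(i, j) if i == 0 then (if j == 0 then a else b)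
                 else (if j == 0 then c else d).

(** A congruence acts on the coordinates by its symmetric square; the last row
    of T is the image of E12 + E21, up to the normalization of [vec]. *)
Lemma vec_congruence X (a b c d : R) (T : 'M[R]_3) : X^T = X ->
  row 0 T = conic a b -> row 1 T = conic c d ->
  T 2 0 = Num.sqrt 2 * (a * c) -> T 2 1 = Num.sqrt 2 * (b * d) ->
  T 2 2 = a * d + b * c ->
  vec ((mx2 a b c d)^T *m X *m mx2 a b c d) = vec X *m T.
Proof.
move=> symX /rowP r0 /rowP r1 T20 T21 T22.
have T0 k : T 0 k = conic a b 0 k by rewrite -r0 mxE.
have T1 k : T 1 k = conic c d 0 k by rewrite -r1 mxE.
apply/rowP; apply: forall_ord3;
  rewrite [RHS]mxE big_ord3 T0 T1 ?T20 ?T21 ?T22 !vecE !mxE !big_ord2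
    !mxE !big_ord2 !mxE /= (symE symX).
- transitivity (X 0 0 * a ^+ 2 + X 1 1 * c ^+ 2 +
    Num.sqrt 2 * Num.sqrt 2 * (X 0 1 * (a * c))); last ring.
  rewrite sqrt2K; ring.
- transitivity (X 0 0 * b ^+ 2 + X 1 1 * d ^+ 2 +
    Num.sqrt 2 * Num.sqrt 2 * (X 0 1 * (b * d))); last ring.
  rewrite sqrt2K; ring.
- ring.
Qed.

Lemma psd_rank1 X : psd X -> \det X = 0 -> exists a b, vec X = conic a b.
Proof.
move=> psdX Xd; have [X0 X1 _] := psd_ge0 psdX.
have [X00|X00] := eqVneq (X 0 0) 0.
  exists 0, (Num.sqrt (X 1 1)); rewrite vec_infinity //.
  apply/rowP; apply: forall_ord3; rewrite !mxE /= ?sqr_sqrtr //; ring.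
exists (Num.sqrt (X 0 0)), (Num.sqrt (X 0 0) * slope X); rewrite vec_slope //.
apply/rowP; apply: forall_ord3; rewrite !mxE /= ?exprMn ?sqr_sqrtr //.
- by rewrite expr1n mulr1.
- transitivity (Num.sqrt 2 * (Num.sqrt (X 0 0) ^+ 2 * slope X)); last ring.
  by rewrite sqr_sqrtr //; ring.
Qed.

(** A singular symmetric matrix is psd or minus a psd matrix, and the pairing
    with the psd matrix X decides which. *)
Lemma psd_of_polar_gt0 X Y : psd X -> Y^T = Y -> \det Y = 0 -> 0 < polar X Y ->
  psd Y.
Proof.
move=> psdX symY Yd XY.
have psd_opp : Y 0 0 <= 0 -> Y 1 1 <= 0 -> polar X Y <= 0.
  move=> Y0 Y1; have psdNY : psd (- Y).
    apply/psdP; first by rewrite linearN /= symY.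
    move: Yd; rewrite !det2 !mxE => Yd; split; lra.
  have := tr_psd_ge0 psdX (psd_adj psdNY).
  have psdadj := psd_adj psdNY.
  rewrite tr_mul_vec ?(psd_sym psdX) ?(psd_sym psdadj) //.
  rewrite -vec_adj trmx_mul tr_lorentz mulmxA -/(polar X (- Y)).
  rewrite !polarE !mxE; lra.
have [_ _ Xd] := psd_ge0 psdX.
apply/psdP => //; rewrite Yd; move: Yd; rewrite det2 (symE symY) => Yd.
have sqY : 0 <= Y 0 1 * Y 0 1 by rewrite -expr2 sqr_ge0.
split=> //; rewrite leNgt; apply/negP => Y_lt0.
  have Y1 : Y 1 1 <= 0 by nra.
  have := psd_opp (ltW Y_lt0) Y1; lra.
have Y0 : Y 0 0 <= 0 by nra.
have := psd_opp Y0 (ltW Y_lt0); lra.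
Qed.

Lemma det_unvec_row T (c : R) r : T *m J *m T^T = c *: J -> J r r = 0 ->
  \det (unvec (row r T)) = 0.
Proof.
move=> TJT Jrr; have := qform_lorentz_vec (tr_unvec (row r T)).
have -> : qform J (vec (unvec (row r T))) = (T *m J *m T^T) r r.
  by rewrite unvecK mulmx_row_col row_mul -tr_row.
by rewrite TJT mxE Jrr mulr0 => /esym/eqP; rewrite mulrn_eq0 => /eqP.
Qed.

(** Similarities of the Lorentz form preserving the cone come from GL(2): the
    images of E11 and E22 are rank-one psd matrices, whose square roots are
    the rows of S, and the image of E12 + E21 is then determined up to a sign,
    which is the relative sign of the two rows. *)
Lemma lorentz_congruence T (c : R) : 0 < c -> T *m J *m T^T = c *: J ->
  psd (unvec (row 0 T)) -> psd (unvec (row 1 T)) ->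
  exists2 S, S \in unitmx &
    forall X, X^T = X -> vec (S^T *m X *m S) = vec X *m T.
Proof.
move=> c_gt0 TJT psd0 psd1.
have ent i j : (T *m J *m T^T) i j = c * J i j by rewrite TJT mxE.
have det0 : \det (unvec (row 0 T)) = 0 by apply: det_unvec_row TJT _; rewrite mxE.
have det1 : \det (unvec (row 1 T)) = 0 by apply: det_unvec_row TJT _; rewrite mxE.
have [a [b r0]] := psd_rank1 psd0 det0.
have [g [d r1]] := psd_rank1 psd1 det1.
rewrite unvecK in r0; rewrite unvecK in r1.
have T0 k : T 0 k = conic a b 0 k by rewrite -r0 mxE.
have T1 k : T 1 k = conic g d 0 k by rewrite -r1 mxE.
pose s2 : R := Num.sqrt 2.
have s2sq : s2 * s2 = 2 := sqrt2K.
set x := T 2 0; set y := T 2 1; set z := T 2 2.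
have := (ent 0 1, ent 0 2, ent 1 2, ent 2 2).
rewrite !mxE !big_ord3 !mxE !big_ord3 !mxE /= !T0 !T1 !mxE /= -/s2 -/x -/y -/z.
move=> [[[e01 e02] e12] e22].
have Delta : (a * d - b * g) ^+ 2 = c.
  have : s2 * s2 * (a * b * g * d) = 2 * (a * b * g * d) by rewrite s2sq.
  lra.
have eq02 : a ^+ 2 * y + b ^+ 2 * x = s2 * (a * b) * z by lra.
have eq12 : g ^+ 2 * y + d ^+ 2 * x = s2 * (g * d) * z by lra.
have eq22 : z ^+ 2 - x * y *+ 2 = c by lra.
(* (x, y, z) is orthogonal to the two null vectors, so it is a multiple of
   the vector that a congruence gives to E12 + E21; pairing with that vector
   yields the factor *)
pose mu := ((a * d + b * g) * z - s2 * (a * g * y + b * d * x)) / c.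
have c_neq0 : c != 0 by rewrite gt_eqF.
have muc : mu * c = (a * d + b * g) * z - s2 * (a * g * y + b * d * x).
  by rewrite /mu mulfVK.
have xE : x = mu * (s2 * (a * g)).
  apply: (mulIf c_neq0); rewrite mulrAC muc.
  transitivity (a ^+ 2 * (s2 * (g * d) * z) + g ^+ 2 * (s2 * (a * b) * z)
    - s2 * s2 * (a ^+ 2 * g ^+ 2 * y + a * b * g * d * x)); last ring.
  rewrite s2sq -eq02 -eq12 -Delta; ring.
have yE : y = mu * (s2 * (b * d)).
  apply: (mulIf c_neq0); rewrite mulrAC muc.
  transitivity (b ^+ 2 * (s2 * (g * d) * z) + d ^+ 2 * (s2 * (a * b) * z)
    - s2 * s2 * (b ^+ 2 * d ^+ 2 * x + a * b * g * d * y)); last ring.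
  rewrite s2sq -eq02 -eq12 -Delta; ring.
have zE : z = mu * (a * d + b * g).
  apply: (mulIf c_neq0); rewrite mulrAC muc.
  transitivity ((a * d + b * g) ^+ 2 * z - s2 *
    (g * d * (a ^+ 2 * y + b ^+ 2 * x) + a * b * (g ^+ 2 * y + d ^+ 2 * x)));
    last ring.
  transitivity ((a * d + b * g) ^+ 2 * z - s2 * s2 * (a * b * g * d * z *+ 2)).
    rewrite s2sq -Delta; ring.
  rewrite eq02 eq12; ring.
have mu2 : mu ^+ 2 = 1.
  apply: (mulIf c_neq0); rewrite mul1r -[RHS]eq22 {1}xE {1}yE zE -Delta.
  transitivity (mu ^+ 2 * ((a * d + b * g) ^+ 2
    - s2 * s2 * (a * b * g * d *+ 2))); last ring.
  rewrite s2sq; ring.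
have unitS a' b' : (a' * d - b' * g) ^+ 2 = c -> mx2 a' b' g d \in unitmx.
  move=> D2; rewrite unitmxE unitfE det2 !mxE /= -sqrf_eq0.
  by rewrite -/(GRing.exp _ 2) D2.
have /eqP := mu2; rewrite sqrf_eq1 => /orP[/eqP mu1|/eqP muN1].
  exists (mx2 a b g d); first exact: unitS.
  move=> X symX; apply: vec_congruence => //.
  - by rewrite -/x xE mu1 mul1r.
  - by rewrite -/y yE mu1 mul1r.
  - by rewrite -/z zE mu1 mul1r.
exists (mx2 (- a) (- b) g d); first by apply: unitS; rewrite -Delta; ring.
move=> X symX; apply: vec_congruence => //.
- by rewrite r0; apply/rowP; apply: forall_ord3; rewrite !mxE /=; ring.
- by rewrite -/s2 -/x xE muN1; ring.
- by rewrite -/s2 -/y yE muN1; ring.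
- by rewrite -/z zE muN1; ring.
Qed.
End Congruence.

(** * Global rigidity *)

Section GlobalRigidity.
Context {R : realType} {p q : nat} {M : 'M[R]_(p, q)}.
Context {A : 'I_p -> 'M[R]_2} {B : 'I_q -> 'M[R]_2}.
Hypothesis M_gt0 : forall i j, 0 < M i j.
Hypothesis M_boundary : boundary_M32 M.
Hypothesis fM : psd_factorization M A B.
Local Notation J := (lorentz R).

Let rkM : \rank M = 3%N := boundary_rank3 M_boundary.

Lemma transition_matrix A2 B2 : psd_factorization M A2 B2 ->
  exists2 T : 'M[R]_3, T \in unitmx &
    rows A2 = rows A *m T /\ cols B = T *m cols B2.
Proof.
move=> fM2; have MAB := factorizationE fM; have MAB2 := factorizationE fM2.
have [/row_fullP[L LA] /row_freeP[W BW]] := rank3_factors rkM MAB.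
have [_ /row_freeP[W2 BW2]] := rank3_factors rkM MAB2.
pose T := cols B *m W2.
have A2T : rows A2 = rows A *m T.
  by rewrite mulmxA -MAB MAB2 -mulmxA BW2 mulmx1.
have BT : cols B = T *m cols B2.
  rewrite -[LHS]mul1mx -LA -mulmxA -MAB MAB2 A2T.
  by rewrite -mulmxA mulmxA LA mul1mx.
exists T; last first.
  by split.
by have [] := @mulmx1_unit _ _ T (cols B2 *m W); first by rewrite mulmxA -BT.
Qed.

(** Let T carry the coordinates of the first factorization to those of the
    second. The form T J T^T is the determinant of the second left factors at
    the first ones, hence nonnegative; at a contact of B j the image is
    orthogonal to the second right factor, hence has nonpositive determinant.
    So T J T^T weakly separates the contacts and T is a similarity of the
    Lorentz form. *)
Theorem boundary_globally_rigid : globally_rigid M A B.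
Proof.
move=> A2 B2 fM2; have [T unitT [A2T BT]] := transition_matrix fM2.
have vecA2 i : vec (A2 i) = vec (A i) *m T by rewrite -!row_rows A2T row_mul.
have vecB j : (vec (B j))^T = T *m (vec (B2 j))^T.
  by rewrite -!tr_col_cols !trmxK BT !colE mulmxA.
have psdA2 i : psd (A2 i) by case: fM2.
have psdB2 j : psd (B2 j) by case: fM2.
have [k TJT] : exists k, T *m J *m T^T + (T *m J *m T^T)^T = k *: J.
  apply: (weak_separation_trivial M_gt0 M_boundary fM) => [i _|j Bd].
    by rewrite -qform_mul -vecA2 qform_psd_ge0.
  rewrite -qform_mul -[X in qform J X]unvecK qform_lorentz_vec ?tr_unvec //.
  rewrite pmulrn_lle0 //; apply: (det_le0_of_tr0 (psdB2 j)); rewrite ?tr_unvec //.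
    apply/eqP => B20; have := trace_right_gt0 M_gt0 rkM fM2 j.
    by rewrite B20 !vecE !mxE addr0 ltxx.
  rewrite mxtrace_mulC tr_mul_vec ?tr_unvec ?(psd_sym (psdB2 j)) // unvecK.
  rewrite -mulmxA -vecB -/(qform _ _) qform_lorentz_vec ?Bd ?mul0rn //.
  exact: psd_sym (right_factor_psd fM j).
pose c := k / 2.
have {}TJT : T *m J *m T^T = c *: J.
  move: TJT; rewrite !trmx_mul trmxK tr_lorentz mulmxA => TJT.
  by rewrite /c mulrC -scalerA -TJT -mulr2n -scalerMnr scalerMnl -mulr_natr mulVf
    ?scale1r.
have c_gt0 : 0 < c.
  have detJ : \det J != 0.
    by rewrite -unitfE -unitmxE; have [] := mulmx1_unit (mul_lorentz R).
  have := congr1 determinant TJT; rewrite !det_mulmx det_tr detZ mulrAC.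
  move=> /(mulIf detJ); rewrite -expr2 => c3.
  have : 0 < c ^+ 3 by rewrite -c3 exprn_even_gt0 //= -unitfE -unitmxE.
  by rewrite exprn_odd_gt0.
have [/row_fullP[L LA] _] := rank3_factors rkM (factorizationE fM).
have col_neq0 (k' : 'I_3) : exists i, vec (A i) 0 k' != 0.
  apply: contrapT => noA; have := congr1 (fun X : 'M[R]_3 => X k' k') LA.
  rewrite !mxE eqxx big1 => [/esym/eqP|i _]; first by rewrite oner_eq0.
  have [->|A0] := eqVneq (rows A i k') 0; first by rewrite mulr0.
  by case: noA; exists i; rewrite -row_rows mxE.
have polarT i (r : 'I_3) :
    polar (A2 i) (unvec (row r T)) = c * (vec (A i) *m J) 0 r.
  rewrite /polar unvecK vecA2 tr_row -[_ *m J](row_id 0) -mulmx_row_col.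
  by rewrite -!mulmxA [T *m (J *m _)]mulmxA TJT -scalemxAr mxE.
have psd_row (r r' : 'I_3) : (forall x : 'rV[R]_3, (x *m J) 0 r = x 0 r') ->
    (forall i, 0 <= vec (A i) 0 r') -> J r r = 0 -> psd (unvec (row r T)).
  move=> Jr Ar' Jrr; have [i Ai] := col_neq0 r'.
  apply: (psd_of_polar_gt0 (psdA2 i)); rewrite ?tr_unvec //.
    exact: det_unvec_row TJT Jrr.
  by rewrite polarT Jr mulr_gt0 // lt_def Ai Ar'.
have [S unitS ST] : exists2 S, S \in unitmx &
    forall X, X^T = X -> vec (S^T *m X *m S) = vec X *m T.
  apply: (lorentz_congruence c_gt0 TJT).
    apply: (psd_row 0 1) => [x|i|]; last by rewrite mxE.
      by rewrite mxE big_ord3 !mxE /=; ring.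
    by rewrite vecE; have [] := psd_ge0 (left_factor_psd fM i).
  apply: (psd_row 1 0) => [x|i|]; last by rewrite mxE.
    by rewrite mxE big_ord3 !mxE /=; ring.
  by rewrite vecE; have [] := psd_ge0 (left_factor_psd fM i).
have A2S i : A2 i = S^T *m A i *m S.
  have symA := psd_sym (left_factor_psd fM i).
  apply: vec_inj; first exact: psd_sym (psdA2 i).
    by rewrite !trmx_mul trmxK symA mulmxA.
  by rewrite ST.
exists S => //; split=> // j.
set C := invmx S *m B j *m (invmx S)^T.
have symC : C^T = C.
  by rewrite /C !trmx_mul trmxK (psd_sym (right_factor_psd fM j)) mulmxA.
have [/row_fullP[L2 LA2] _] := rank3_factors rkM (factorizationE fM2).
apply: vec_inj; [exact: psd_sym (psdB2 j)|exact: symC|].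
apply: trmx_inj; rewrite -[LHS]mul1mx -[RHS]mul1mx -LA2 -!mulmxA.
congr (L2 *m _); apply/colP => i.
rewrite [LHS]mulmx_row_col [RHS]mulmx_row_col !row_rows !col_id.
rewrite -(tr_mul_vec (psd_sym (psdA2 i)) (psd_sym (psdB2 j))).
rewrite -(tr_mul_vec (psd_sym (psdA2 i)) symC).
have [_ _ <-] := fM2; have [_ _ ->] := fM.
rewrite A2S /C -!mulmxA mulKVmx // [RHS]mxtrace_mulC -!mulmxA.
by rewrite -trmx_mul mulmxV // trmx1 mulmx1.
Qed.

Lemma globally_locally_rigid : globally_rigid M A B -> locally_rigid M A B.
Proof. by move=> glob; exists 1 => // A' B' fM' _ _; apply: glob. Qed.
End GlobalRigidity.

Theorem corollary3 (R : realType) (p q : nat) (M : 'M[R]_(p, q))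
    (M_gt0 : forall i j, 0 < M i j)
    (M_boundary : @boundary_M32 R p q M)
    (A : 'I_p -> 'M[R]_2) (B : 'I_q -> 'M[R]_2)
    (AB_fact : psd_factorization M A B) :
  [/\ inf_rigid 1 A B, inf_rigid 2 A B,
      locally_rigid M A B & globally_rigid M A B].
Proof.
split.
- exact: boundary_rigid1 M_gt0 M_boundary AB_fact.
- exact: boundary_rigid2 M_gt0 M_boundary AB_fact.
- exact/globally_locally_rigid/(boundary_globally_rigid M_gt0 M_boundary AB_fact).
- exact: boundary_globally_rigid M_gt0 M_boundary AB_fact.
Qed.
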